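(* Let $(S,E)$ be a finite simple graph, let $V$ be the $\mathbb Q$-vector space with basis $S$, let $\mathcal F_3(V)$ be the free $3$-step nilpotent Lie algebra over $\mathbb Q$ on $V$, and let $\mathcal Q=\mathcal F_3(V)/\mathcal I$, where $\mathcal I$ is the ideal of $\mathcal F_3(V)$ generated by the elements $[\alpha,\beta]$ with $\alpha,\beta\in S$ such that $\alpha\beta$ is not an edge. Let $V_3\subset\mathcal Q$ be the subspace spanned by all $[\alpha,[\beta,\gamma]]$ with $\alpha,\beta,\gamma\in S$ and $\beta\gamma\in E$. Let $X$ be a nonzero vector in $V_3$ and let $\mathcal M=\mathcal Q/\langle X\rangle$, where $\langle X\rangle$ is the ideal of $\mathcal Q$ generated by $X$ (which is the one-dimensional subspace spanned by $X$). Then the Lie algebra $\mathcal M$ does not admit a hyperbolic automorphism whose characteristic polynomial has integer coefficients and unit constant term.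
   Context: $(S,E)$ has vertex set $S$ and edge set $E$; $\alpha\beta\in E$ means that $\alpha,\beta$ are joined by an edge. An automorphism is hyperbolic if all of its (complex) eigenvalues have modulus different from $1$. ''Unit constant term'' means that the constant term is $\pm1$. *)

(* Defs.v *)
From HB Require Import structures.
From mathcomp Require Import all_boot all_order all_algebra all_field.
From mathcomp Require Import ring.

Set Implicit Arguments.
Unset Strict Implicit.
Unset Printing Implicit Defensive.

Import Order.TTheory GRing.Theory Num.Theory.
Local Open Scope ring_scope.

HB.mixin Record Lmodule_isLie (K : fieldType) L of GRing.Lmodule K L := {
  lie : L -> L -> L;
  lie_linearl : forall z, linear (lie^~ z);
  lie_linearr : forall z, linear (lie z);
  lie_alt : forall x, lie x x = 0;
  lie_jacobi : forall x y z,
    lie x (lie y z) + lie y (lie z x) + lie z (lie x y) = 0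
}.

#[short(type="lieAlgType")]
HB.structure Definition LieAlg (K : fieldType) :=
  {L of GRing.Lmodule K L & Lmodule_isLie K L}.

#[short(type="vectLieType")]
HB.structure Definition VectLie (K : fieldType) :=
  {L of Vector K L & Lmodule_isLie K L}.

Section LieTheory.
Variables (K : fieldType) (L : lieAlgType K).
Implicit Types x y z t : L.

Lemma lieDl x y z : lie (x + y) z = lie x z + lie y z.
Proof. by have := lie_linearl z 1 x y; rewrite !scale1r. Qed.
Lemma lieDr x y z : lie z (x + y) = lie z x + lie z y.
Proof. by have := lie_linearr z 1 x y; rewrite !scale1r. Qed.
Lemma lie0l z : lie 0 z = 0.
Proof. by apply: (addIr (lie 0 z)); rewrite -lieDl !add0r. Qed.
Lemma lie0r z : lie z 0 = 0.
Proof. by apply: (addIr (lie z 0)); rewrite -lieDr !add0r. Qed.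
Lemma lieZl a x z : lie (a *: x) z = a *: lie x z.
Proof. by have := lie_linearl z a x 0; rewrite lie0l !addr0. Qed.
Lemma lieZr a x z : lie z (a *: x) = a *: lie z x.
Proof. by have := lie_linearr z a x 0; rewrite lie0r !addr0. Qed.
Lemma lieNl x z : lie (- x) z = - lie x z.
Proof. by rewrite -scaleN1r lieZl scaleN1r. Qed.
Lemma lieNr x z : lie z (- x) = - lie z x.
Proof. by rewrite -scaleN1r lieZr scaleN1r. Qed.
Lemma lieC x y : lie x y = - lie y x.
Proof.
apply/eqP; rewrite -addr_eq0; apply/eqP.
by have := lie_alt (x + y); rewrite lieDl !lieDr !lie_alt add0r addr0.
Qed.
Lemma lie_suml I (r : seq I) (P : pred I) (F : I -> L) z :
  lie (\sum_(i <- r | P i) F i) z = \sum_(i <- r | P i) lie (F i) z.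
Proof.
elim/big_rec2: _ => [|i y1 y2 _ <-]; first exact: lie0l.
exact: lieDl.
Qed.
Lemma lie_sumr I (r : seq I) (P : pred I) (F : I -> L) z :
  lie z (\sum_(i <- r | P i) F i) = \sum_(i <- r | P i) lie z (F i).
Proof.
elim/big_rec2: _ => [|i y1 y2 _ <-]; first exact: lie0r.
exact: lieDr.
Qed.

(* Nilpotency of step at most 3: right-normed brackets span the lower central
   series. *)
Definition nil_le3 : Prop := forall x y z t, lie x (lie y (lie z t)) = 0.

End LieTheory.
Arguments nil_le3 {K} L.

Definition lie_morphism (K : fieldType) (L L' : lieAlgType K) (f : L -> L') :=
  forall x y, f (lie x y) = lie (f x) (f y).

(* Both generated subalgebras and generated ideals are obtained by iterating
   an inflationary operator on subspaces dim L times. *)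
Section Closure.
Variables (K : fieldType) (V : vectType K) (F : {vspace V} -> {vspace V}).
Hypothesis F_infl : forall U, (U <= F U)%VS.

Lemma iter_subv n U : (U <= iter n F U)%VS.
Proof. by elim: n => [|n IH] /=; [exact: subvv|apply: subv_trans IH _]. Qed.

Lemma iter_fixed U : F (iter (dim V) F U) = iter (dim V) F U.
Proof.
have H n : F (iter n F U) = iter n F U \/ (n <= \dim (iter n F U))%N.
  elim: n => [|n [IH|IH]]; first by right.
    by left; rewrite iterS !IH.
  have [E|E] := eqVneq (F (iter n F U)) (iter n F U).
    by left; rewrite iterS !E.
  right; apply: leq_ltn_trans IH _; rewrite /= ltnNge.
  apply: contraNN E => le; rewrite eq_sym eqEdim le andbT; exact: F_infl.
case: (H (dim V)) => // le; set W := iter _ _ _ in le *.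
have EW : W = fullv by apply/eqP; rewrite eqEdim subvf dimvf.
by apply/eqP; rewrite eqEsubv F_infl EW subvf.
Qed.

End Closure.

Section LieSubspaces.
Variables (K : fieldType) (L : vectLieType K).
Implicit Types (U W : {vspace L}) (X : seq L).

Definition lie_span U W : {vspace L} :=
  <<[seq lie u w | u <- vbasis U, w <- vbasis W]>>%VS.

Lemma lie_spanP U W Z :
  (lie_span U W <= Z)%VS <-> {in U & W, forall u w, lie u w \in Z}.
Proof.
split=> [/span_subvP sZ u w uU wW|H].
  rewrite (coord_vbasis uU) (coord_vbasis wW) lie_suml; apply: memv_suml => i _.
  rewrite lie_sumr; apply: memv_suml => j _; rewrite lieZl lieZr.
  by apply/memvZ/memvZ/sZ/allpairs_f; apply: mem_nth; rewrite size_tuple.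
apply/span_subvP => z /allpairsP[[u w] /= [uU wW ->]].
by apply: H; apply: vbasis_mem.
Qed.

Lemma mem_lie_span U W : {in U & W, forall u w, lie u w \in lie_span U W}.
Proof. exact/lie_spanP/subvv. Qed.

Definition is_subalg U : Prop := {in U &, forall x y, lie x y \in U}.
Definition is_ideal U : Prop := forall x y, y \in U -> lie x y \in U.

Definition subalg_gen_vs X : {vspace L} :=
  iter (dim L) (fun U => U + lie_span U U)%VS <<X>>%VS.
Definition ideal_gen_vs X : {vspace L} :=
  iter (dim L) (fun U => U + lie_span fullv U)%VS <<X>>%VS.

Lemma subalg_gen_subalg X : is_subalg (subalg_gen_vs X).
Proof.
move=> x y xU yU; set F := fun U => (U + lie_span U U)%VS.
rewrite -[subalg_gen_vs X](@iter_fixed _ _ F); last by move=> U; apply: addvSl.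
by apply/(subvP (addvSr _ _))/mem_lie_span.
Qed.

Lemma ideal_gen_ideal X : is_ideal (ideal_gen_vs X).
Proof.
move=> x y yU; set F := fun U => (U + lie_span fullv U)%VS.
rewrite -[ideal_gen_vs X](@iter_fixed _ _ F); last by move=> U; apply: addvSl.
by apply/(subvP (addvSr _ _))/mem_lie_span => //; apply: memvf.
Qed.

Lemma mem_subalg_gen X : {subset X <= subalg_gen_vs X}.
Proof.
by move=> x /memv_span; apply/subvP/iter_subv => U; apply: addvSl.
Qed.

Lemma mem_ideal_gen X : {subset X <= ideal_gen_vs X}.
Proof.
by move=> x /memv_span; apply/subvP/iter_subv => U; apply: addvSl.
Qed.

Lemma span_ind X (P : L -> Prop) :
  P 0 -> (forall a x y, P x -> P y -> P (a *: x + y)) ->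
  {in X, forall x, P x} -> {in <<X>>%VS, forall x, P x}.
Proof.
move=> P0 PD PX x /(coord_span (X := in_tuple X)) ->.
apply: big_ind => // [u v Pu Pv|i _]; first by rewrite -[u]scale1r; apply: PD.
by rewrite -[_ *: _]addr0; apply: PD => //; apply/PX/mem_nth.
Qed.

Lemma subalg_gen_ind X (P : L -> Prop) :
  P 0 -> (forall a x y, P x -> P y -> P (a *: x + y)) ->
  (forall x y, x \in subalg_gen_vs X -> y \in subalg_gen_vs X ->
     P x -> P y -> P (lie x y)) ->
  {in X, forall x, P x} -> {in subalg_gen_vs X, forall x, P x}.
Proof.
move=> P0 PD PL PX.
have sub : forall n, (iter n (fun U => U + lie_span U U)%VS <<X>>%VS
                        <= subalg_gen_vs X)%VS.
  elim=> [|n IH] /=; first by apply: iter_subv => U; apply: addvSl.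
  rewrite subv_add IH; apply/lie_spanP => u w /(subvP IH) uU /(subvP IH) wU.
  exact: subalg_gen_subalg.
rewrite /subalg_gen_vs; elim: (dim L) => [|n IH] /=; first exact: (@span_ind _ P).
move=> x /memv_addP[u uU [v vV ->]]; rewrite -[u]scale1r; apply: (PD); first exact: IH.
move: v vV; apply: (@span_ind _ P) => // z /allpairsP[[a b] /= [/vbasis_mem aU /vbasis_mem bU ->]].
by apply: PL; [apply/(subvP (sub n))|apply/(subvP (sub n))|apply: IH|apply: IH].
Qed.

Lemma subalg_gen_min X U :
  is_subalg U -> {subset X <= U} -> (subalg_gen_vs X <= U)%VS.
Proof.
move=> sU XU; apply/subvP; apply: subalg_gen_ind => //; first exact: mem0v.
  by move=> a x y xU yU; apply: memvD => //; apply: memvZ.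
by move=> x y _ _; apply: sU.
Qed.

Lemma ideal_gen_min X U :
  is_ideal U -> {subset X <= U} -> (ideal_gen_vs X <= U)%VS.
Proof.
move=> iU XU; rewrite /ideal_gen_vs; elim: (dim L) => [|n IH] /=.
  exact/span_subvP.
rewrite subv_add IH; apply/lie_spanP => u w _ /(subvP IH); exact: iU.
Qed.

Record lie_subalg := LieSubalg {
  subalg_vs :> {vspace L}; subalg_closed : is_subalg subalg_vs }.
Record lie_ideal := LieIdeal {
  ideal_vs :> {vspace L}; ideal_closed : is_ideal ideal_vs }.

Definition subalg_gen X := LieSubalg (@subalg_gen_subalg X).
Definition ideal_gen X := LieIdeal (@ideal_gen_ideal X).

End LieSubspaces.

Section SubLie.
Variables (K : fieldType) (L : vectLieType K) (U : lie_subalg L).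

Definition subLie : Type := subvs_of U.
HB.instance Definition _ := Vector.on subLie.

Definition sub_lie (x y : subLie) : subLie := vsproj U (lie (vsval x) (vsval y)).

Lemma val_sub_lie x y : vsval (sub_lie x y) = lie (vsval x) (vsval y).
Proof. by rewrite vsprojK //; apply: subalg_closed; apply: subvsP. Qed.

Fact sub_lie_linearl z : linear (sub_lie^~ z).
Proof. by move=> a x y; rewrite /sub_lie linearP lieDl lieZl linearP. Qed.
Fact sub_lie_linearr z : linear (sub_lie z).
Proof. by move=> a x y; rewrite /sub_lie linearP lieDr lieZr linearP. Qed.
Fact sub_lie_alt x : sub_lie x x = 0.
Proof. by rewrite /sub_lie lie_alt linear0. Qed.
Fact sub_lie_jacobi x y z :
  sub_lie x (sub_lie y z) + sub_lie y (sub_lie z x) + sub_lie z (sub_lie x y) = 0.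
Proof. by apply: subvs_inj; rewrite !linearD /= !val_sub_lie lie_jacobi. Qed.

HB.instance Definition _ := Lmodule_isLie.Build K subLie
  sub_lie_linearl sub_lie_linearr sub_lie_alt sub_lie_jacobi.

Lemma subLieE (x y : subLie) : vsval (lie x y) = lie (vsval x) (vsval y).
Proof. exact: val_sub_lie. Qed.

End SubLie.

(* The quotient L / I is carried by the linear complement of I chosen by the
   library; quo_pi is the canonical projection. *)
Section QuoLie.
Variables (K : fieldType) (L : vectLieType K) (I : lie_ideal L).

Definition quoLie : Type := subvs_of (I^C)%VS.
HB.instance Definition _ := Vector.on quoLie.

Definition quo_pi : 'Hom(L, quoLie) :=
  linfun (vsproj (I^C)%VS \o daddv_pi (I^C)%VS I).

Let trivI : (I^C :&: I = 0)%VS. Proof. by rewrite capvC capv_compl. Qed.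

Let quo_piE x : vsval (quo_pi x) = daddv_pi (I^C)%VS I x.
Proof. by rewrite lfunE /= vsprojK // memv_pi. Qed.

Definition quo_repr (x : quoLie) : L := vsval x.

Lemma quo_reprK : cancel quo_repr quo_pi.
Proof.
by move=> x; apply: subvs_inj; rewrite quo_piE daddv_pi_id //; apply: subvsP.
Qed.

Lemma quo_piK x : x - quo_repr (quo_pi x) \in I.
Proof.
rewrite /quo_repr quo_piE.
have {1}-> : x = daddv_pi (I^C)%VS I x + daddv_pi I (I^C)%VS x.
  by rewrite daddv_pi_add // addvC addv_complf memvf.
by rewrite addrAC subrr add0r memv_pi.
Qed.

Lemma lker_quo_pi : lker quo_pi = I.
Proof.
apply/vspaceP => x; rewrite memv_ker; apply/eqP/idP => [x0|xI].
  by have := quo_piK x; rewrite x0 (_ : quo_repr 0 = 0) ?subr0 //; apply: linear0.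
apply: subvs_inj; rewrite linear0; apply/eqP; rewrite -memv0 -trivI memv_cap.
rewrite subvsP /= -[vsval _]/(quo_repr _) -[quo_repr _](subrK x) memvD //.
by rewrite -opprB memvN quo_piK.
Qed.

Lemma quo_pi_eq x y : x - y \in I -> quo_pi x = quo_pi y.
Proof. by rewrite -lker_quo_pi memv_ker linearB subr_eq0 => /eqP. Qed.

Lemma quo_pi_surj x : exists y, x = quo_pi y.
Proof. by exists (quo_repr x); rewrite quo_reprK. Qed.

Definition quo_lie (x y : quoLie) : quoLie :=
  quo_pi (lie (quo_repr x) (quo_repr y)).

Lemma quo_lieE x y : quo_lie (quo_pi x) (quo_pi y) = quo_pi (lie x y).
Proof.
apply/esym/quo_pi_eq; set x' := quo_repr _; set y' := quo_repr _.
have -> : lie x y - lie x' y' = lie x (y - y') + lie (x - x') y'.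
  by rewrite lieDr lieDl lieNr lieNl addrA subrK.
rewrite memvD //; first by apply: ideal_closed; apply: quo_piK.
by rewrite lieC memvN; apply: ideal_closed; apply: quo_piK.
Qed.

Fact quo_lie_linearl z : linear (quo_lie^~ z).
Proof.
move=> a x y.
rewrite /quo_lie /quo_repr linearP lieDl lieZl linearP; done.
Qed.
Fact quo_lie_linearr z : linear (quo_lie z).
Proof.
move=> a x y.
rewrite /quo_lie /quo_repr linearP lieDr lieZr linearP; done.
Qed.
Fact quo_lie_alt x : quo_lie x x = 0.
Proof. by rewrite /quo_lie lie_alt linear0. Qed.
Fact quo_lie_jacobi x y z :
  quo_lie x (quo_lie y z) + quo_lie y (quo_lie z x) + quo_lie z (quo_lie x y) = 0.
Proof.
have [x' ->] := quo_pi_surj x; have [y' ->] := quo_pi_surj y.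
have [z' ->] := quo_pi_surj z.
by rewrite !quo_lieE -!linearD lie_jacobi linear0.
Qed.

HB.instance Definition _ := Lmodule_isLie.Build K quoLie
  quo_lie_linearl quo_lie_linearr quo_lie_alt quo_lie_jacobi.

Lemma quo_pi_lie : lie_morphism quo_pi.
Proof. by move=> x y; rewrite -quo_lieE. Qed.

Lemma quo_nil_le3 : nil_le3 L -> nil_le3 quoLie.
Proof.
move=> nL x y z t.
have [x' ->] := quo_pi_surj x; have [y' ->] := quo_pi_surj y.
have [z' ->] := quo_pi_surj z; have [t' ->] := quo_pi_surj t.
by rewrite -(quo_pi_lie z' t') -(quo_pi_lie y') -(quo_pi_lie x') nL linear0.
Qed.

End QuoLie.

(* T(V)_+ / T^{>= 4}(V) for V with basis S, as a Lie algebra for the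
   commutator x y - y x: a triple of tensors of degrees 1, 2 and 3. *)
Section Tensor3.
Variable S : finType.

Definition tensor3 : Type :=
  ({ffun S -> rat^o} * {ffun S * S -> rat^o} * {ffun S * S * S -> rat^o})%type.
HB.instance Definition _ := Vector.on tensor3.
Implicit Types x y z : tensor3.

Definition tensor3_mul x y : tensor3 :=
  ((0, [ffun p => x.1.1 p.1 * y.1.1 p.2]),
   [ffun p => x.1.1 p.1.1 * y.1.2 (p.1.2, p.2) + x.1.2 p.1 * y.1.1 p.2]).

Definition tensor3_lie x y : tensor3 := tensor3_mul x y - tensor3_mul y x.

Lemma tensor3P x y :
  (forall s, x.1.1 s = y.1.1 s) -> (forall p, x.1.2 p = y.1.2 p) ->
  (forall p, x.2 p = y.2 p) -> x = y.
Proof.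
case: x y => [[x1 x2] x3] [[y1 y2] y3] /= H1 H2 H3.
by congr (_, _, _); apply/ffunP.
Qed.

Fact tensor3_lie_linearl z : linear (tensor3_lie^~ z).
Proof.
move=> a x y; apply: tensor3P => p; rewrite !ffunE /= ?ffunE ?scaler0 ?subr0 ?addr0 //=.
- by rewrite /GRing.scale /=; ring.
- by rewrite /GRing.scale /=; ring.
Qed.
Fact tensor3_lie_linearr z : linear (tensor3_lie z).
Proof.
move=> a x y; apply: tensor3P => p; rewrite !ffunE /= ?ffunE ?scaler0 ?subr0 ?addr0 //=.
- by rewrite /GRing.scale /=; ring.
- by rewrite /GRing.scale /=; ring.
Qed.
Fact tensor3_lie_alt x : tensor3_lie x x = 0.
Proof. exact: subrr. Qed.
Fact tensor3_lie_jacobi x y z :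
  tensor3_lie x (tensor3_lie y z) + tensor3_lie y (tensor3_lie z x)
    + tensor3_lie z (tensor3_lie x y) = 0.
Proof.
apply: tensor3P => p; rewrite !ffunE /= ?ffunE /= ?subr0 ?addr0 ?mul0r ?mulr0 //=.
by ring.
Qed.

HB.instance Definition _ := Lmodule_isLie.Build rat tensor3
  tensor3_lie_linearl tensor3_lie_linearr tensor3_lie_alt tensor3_lie_jacobi.

Definition tensor3_gen (s : S) : tensor3 := (([ffun t => (t == s)%:R], 0), 0).

End Tensor3.

(* The free 3-step nilpotent Lie algebra over rat on the vector space with
   basis S: the Lie subalgebra generated by S in the truncated tensor algebra.
   Its universal property is free_nil3_exists and free_nil3_unique below. *)
Section FreeNil3.
Variable S : finType.

Definition free_nil3 : Type :=
  subLie (subalg_gen [seq tensor3_gen s | s <- enum S]).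
HB.instance Definition _ := VectLie.on free_nil3.

Definition free_gen (s : S) : free_nil3 := vsproj _ (tensor3_gen s).

Lemma tensor3_nil : nil_le3 (tensor3 S).
Proof.
move=> x y z t; apply: tensor3P => p; rewrite /lie /= !ffunE /= ?ffunE /=;
  by rewrite ?(mul0r, mulr0, subr0, addr0).
Qed.

Lemma free_nil3_nil : nil_le3 free_nil3.
Proof. by move=> x y z t; apply: subvs_inj; rewrite !subLieE tensor3_nil. Qed.

Lemma val_free_gen s : vsval (free_gen s) = tensor3_gen s.
Proof.
by rewrite vsprojK //; apply/mem_subalg_gen/map_f; rewrite mem_enum.
Qed.

Theorem free_nil3_unique (L : lieAlgType rat) (f h : {linear free_nil3 -> L}) :
  lie_morphism f -> lie_morphism h ->
  (forall s, f (free_gen s) = h (free_gen s)) -> f =1 h.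
Proof.
move=> fL hL fh x; rewrite -[x]vsvalK.
move: (vsval x) (subvsP x); apply: subalg_gen_ind => //.
- by rewrite !linear0.
- by move=> a u v; rewrite !linearP => -> ->.
- move=> u v uU vU fu fv.
  suff -> : vsproj _ (lie u v) = lie (vsproj _ u : free_nil3) (vsproj _ v).
    by rewrite fL hL fu fv.
  by apply: subvs_inj; rewrite subLieE !vsprojK //; apply: subalg_gen_subalg.
- by move=> u /mapP[s _ ->]; rewrite -/(free_gen s) fh.
Qed.

Lemma free_nil3_skew (x : free_nil3) s t :
  (vsval x).1.2 (s, t) = - (vsval x).1.2 (t, s).
Proof.
move: (vsval x) (subvsP x) s t; apply: subalg_gen_ind => [s t|a u v Pu Pv s t|u v _ _ _ _ s t|_ /mapP[r _ ->] s t].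
- by rewrite !ffunE oppr0.
- by rewrite !ffunE /= Pu Pv /GRing.scale /=; ring.
- by rewrite /lie /= !ffunE /=; ring.
- by rewrite !ffunE oppr0.
Qed.

Section Lift.
Variables (L : lieAlgType rat) (nL : nil_le3 L) (g : S -> L).

(* Left-normed bracketings of words, divided by the degree. *)
Let D1 (x : tensor3 S) : L := \sum_s x.1.1 s *: g s.
Let D2 (x : tensor3 S) : L :=
  2^-1 *: (\sum_p x.1.2 p *: lie (g p.1) (g p.2)).
Let D3 (x : tensor3 S) : L :=
  3^-1 *: (\sum_p x.2 p *: lie (lie (g p.1.1) (g p.1.2)) (g p.2)).

Definition free_lift (x : free_nil3) : L :=
  D1 (vsval x) + D2 (vsval x) + D3 (vsval x).

Fact free_lift_linear : linear free_lift.
Proof.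
move=> a x y; rewrite /free_lift linearP /=; set u := vsval x; set v := vsval y.
have E1 : D1 (a *: u + v) = a *: D1 u + D1 v.
  rewrite /D1 scaler_sumr -big_split; apply: eq_bigr => s _ /=.
  by rewrite !ffunE scalerDl scalerA.
have E2 : D2 (a *: u + v) = a *: D2 u + D2 v.
  rewrite /D2 !scaler_sumr -big_split; apply: eq_bigr => s _ /=.
  by rewrite !ffunE !scalerA -scalerDl; congr (_ *: _); rewrite /GRing.scale /=; ring.
have E3 : D3 (a *: u + v) = a *: D3 u + D3 v.
  rewrite /D3 !scaler_sumr -big_split; apply: eq_bigr => s _ /=.
  by rewrite !ffunE !scalerA -scalerDl; congr (_ *: _); rewrite /GRing.scale /=; ring.
rewrite E1 E2 E3 !scalerDr (addrACA (a *: D1 u)); exact: addrACA.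
Qed.
HB.instance Definition _ := GRing.isLinear.Build rat free_nil3 L *:%R
  free_lift free_lift_linear.

Let nil_l (a b c d : L) : lie a (lie (lie b c) d) = 0.
Proof. by rewrite (lieC (lie b c)) lieNr nL oppr0. Qed.
Let nil_m (a b c d : L) : lie (lie a b) (lie c d) = 0.
Proof.
have := lie_jacobi a b (lie c d); rewrite nL (lieC (lie c d) a) lieNr nL oppr0 !add0r lieC.
by move=> /eqP; rewrite oppr_eq0 => /eqP.
Qed.

Let N2 (u : tensor3 S) : L := \sum_p u.1.2 p *: lie (g p.1) (g p.2).

Let N2_N2 u v : lie (N2 u) (N2 v) = 0.
Proof.
rewrite lie_suml big1 // => p _; rewrite lie_sumr big1 // => q _.
by rewrite lieZl lieZr nil_m !scaler0.
Qed.
Let lie_D3 a v : lie a (D3 v) = 0.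
Proof.
rewrite lieZr lie_sumr big1 ?scaler0 // => p _.
by rewrite lieZr nil_l scaler0.
Qed.

Let D11 (u v : tensor3 S) :
  \sum_p (u.1.1 p.1 * v.1.1 p.2) *: lie (g p.1) (g p.2) = lie (D1 u) (D1 v).
Proof.
rewrite -(pair_bigA _ (fun s t => (u.1.1 s * v.1.1 t) *: lie (g s) (g t))).
rewrite lie_suml; apply: eq_bigr => s _; rewrite lie_sumr.
by apply: eq_bigr => t _; rewrite lieZl lieZr scalerA.
Qed.

Let D21 (u v : tensor3 S) :
  \sum_p (u.1.2 p.1 * v.1.1 p.2) *: lie (lie (g p.1.1) (g p.1.2)) (g p.2)
    = lie (N2 u) (D1 v).
Proof.
rewrite -(pair_bigA _ (fun s t =>
  (u.1.2 s * v.1.1 t) *: lie (lie (g s.1) (g s.2)) (g t))).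
rewrite lie_suml; apply: eq_bigr => s _; rewrite lie_sumr.
by apply: eq_bigr => t _; rewrite lieZl lieZr scalerA.
Qed.

Let D12 (u v : tensor3 S) : (forall s t, v.1.2 (s, t) = - v.1.2 (t, s)) ->
  \sum_p (u.1.1 p.1.1 * v.1.2 (p.1.2, p.2)) *:
     lie (lie (g p.1.1) (g p.1.2)) (g p.2)
    = 2^-1 *: lie (D1 u) (N2 v).
Proof.
move=> vC; pose T s t r := (u.1.1 s * v.1.2 (t, r)) *: lie (lie (g s) (g t)) (g r).
transitivity (\sum_s \sum_t \sum_r T s t r).
  by rewrite pair_bigA pair_bigA.
have E : \sum_s \sum_t \sum_r T s t r = \sum_s \sum_t \sum_r
    - ((u.1.1 s * v.1.2 (t, r)) *: lie (lie (g s) (g r)) (g t)).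
  apply: eq_bigr => s _; rewrite exchange_big; apply: eq_bigr => t _.
  by apply: eq_bigr => r _; rewrite /T vC mulrN scaleNr.
have E2 : \sum_s \sum_t \sum_r T s t r + \sum_s \sum_t \sum_r T s t r
    = lie (D1 u) (N2 v).
  have -> : N2 v = \sum_t \sum_r v.1.2 (t, r) *: lie (g t) (g r).
    by rewrite pair_bigA; apply: eq_bigr => -[].
  rewrite {2}E lie_suml -big_split; apply: eq_bigr => s _ /=.
  rewrite lie_sumr -big_split; apply: eq_bigr => t _ /=.
  rewrite lie_sumr -big_split; apply: eq_bigr => r _ /=.
  rewrite /T lieZl lieZr scalerA -scalerBr; congr (_ *: _).
  have /eqP := lie_jacobi (g s) (g t) (g r).
  rewrite -addrA addr_eq0 => /eqP->.
  rewrite (lieC (lie (g s) (g t))) (lieC (lie (g s) (g r))) (lieC (g r) (g s)).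
  by rewrite lieNr opprK opprD opprK addrC.
by rewrite -E2 -mulr2n -scaler_nat scalerA mulVf // scale1r.
Qed.

Lemma free_lift_lie : lie_morphism free_lift.
Proof.
move=> x y; rewrite /free_lift subLieE.
have uC := free_nil3_skew x; have vC := free_nil3_skew y.
set u := vsval x in uC *; set v := vsval y in vC *.
have -> : D1 (lie u v) = 0.
  by apply: big1 => s _; rewrite /lie /= !ffunE subr0 scale0r.
have -> : D2 (lie u v) = lie (D1 u) (D1 v).
  rewrite /D2; transitivity (2^-1 *: (lie (D1 u) (D1 v) - lie (D1 v) (D1 u))).
    congr (_ *: _); rewrite -!D11 -sumrB; apply: eq_bigr => p _.
    by rewrite -scalerBl /lie /= !ffunE.
  by rewrite (lieC (D1 v)) opprK -mulr2n -scaler_nat scalerA mulVf // scale1r.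
have -> : D3 (lie u v) = 2^-1 *: (lie (D1 u) (N2 v) + lie (N2 u) (D1 v)).
  rewrite /D3; transitivity (3^-1 *:
     (2^-1 *: lie (D1 u) (N2 v) + lie (N2 u) (D1 v) -
      (2^-1 *: lie (D1 v) (N2 u) + lie (N2 v) (D1 u)))).
    congr (_ *: _); rewrite -!D12 // -!D21 -!big_split -sumrB /=.
    apply: eq_bigr => p _; rewrite -!scalerDl -scalerBl.
    by rewrite /lie /= !ffunE.
  rewrite (lieC (D1 v)) (lieC (N2 v)) scalerN -opprD opprK.
  set P := lie _ _; set Q := lie _ _.
  have -> : 2^-1 *: P + Q + (2^-1 *: Q + P) = (3 / 2) *: (P + Q).
    have -> : 3 / 2 = 2^-1 + 1 :> rat by [].
    by rewrite scalerDr !scalerDl !scale1r addrACA [Q + P]addrC addrACA.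
  by rewrite scalerA.
have DN w : D2 w = 2^-1 *: N2 w by [].
rewrite add0r !lieDl !lieDr !lie_D3 !addr0.
rewrite [lie (D3 u) _]lieC [lie (D3 u) (D2 v)]lieC !lie_D3 !oppr0 !addr0.
by rewrite !DN !lieZl !lieZr N2_N2 !scaler0 addr0 -addrA scalerDr.
Qed.

Lemma free_lift_gen s : free_lift (free_gen s) = g s.
Proof.
rewrite /free_lift val_free_gen /D1 /D2 /D3 (bigD1 s) //= ffunE eqxx scale1r.
rewrite !big1 ?scaler0 ?addr0 // => [p _|p _|t ts]; rewrite ffunE.
- exact: scale0r.
- exact: scale0r.
- by rewrite (negPf ts) scale0r.
Qed.

End Lift.

Theorem free_nil3_exists (L : lieAlgType rat) (g : S -> L) : nil_le3 L ->
  exists f : {linear free_nil3 -> L},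
    lie_morphism f /\ forall s, f (free_gen s) = g s.
Proof.
move=> nL; exists (free_lift g).
by split; [exact: free_lift_lie|exact: free_lift_gen].
Qed.

End FreeNil3.

Section GraphLie.
Variables (S : finType) (E : rel S).

(* Pairs p with p.1 = p.2 only contribute the generator 0. *)
Definition nonedge_ideal : lie_ideal (free_nil3 S) :=
  ideal_gen [seq lie (free_gen p.1) (free_gen p.2)
            | p : S * S <- enum predT & ~~ E p.1 p.2].

Definition graph_lie : Type := quoLie nonedge_ideal.
HB.instance Definition _ := VectLie.on graph_lie.

Definition vert (s : S) : graph_lie := quo_pi nonedge_ideal (free_gen s).

Definition V3 : {vspace graph_lie} :=
  <<[seq lie (vert p.1.1) (lie (vert p.1.2) (vert p.2))
    | p : S * S * S <- enum predT & E p.1.2 p.2]>>%VS.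

Lemma graph_lie_nil : nil_le3 graph_lie.
Proof. exact/quo_nil_le3/free_nil3_nil. Qed.

Lemma V3_central x y : x \in V3 -> lie y x = 0.
Proof.
move: x; apply: span_ind => [|a u v u0 v0|_ /mapP[p _ ->]].
- exact: lie0r.
- by rewrite lieDr lieZr u0 v0 scaler0 addr0.
- exact: graph_lie_nil.
Qed.

Lemma ideal_gen_V3 X : X \in V3 -> ideal_gen [:: X] = <[X]>%VS :> {vspace _}.
Proof.
move=> XV; apply/eqP; rewrite eqEsubv -memvE mem_ideal_gen ?mem_head // andbT.
apply: ideal_gen_min => [y _ /vlineP[k ->]|y]; last first.
  by rewrite inE => /eqP->; apply: memv_line.
by rewrite lieZr V3_central // scaler0 mem0v.
Qed.

End GraphLie.

Section Automorphisms.
Variables (M : vectLieType rat) (f : 'End(M)).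

Definition lie_automorphism : Prop := lie_morphism f /\ bijective f.

Definition lfun_mx : 'M[rat]_(\dim {:M}) :=
  passmx.mxof (vbasis {:M}) (vbasis {:M}) f.

(* The complex eigenvalues of a rational matrix are algebraic, so they all
   lie in algC. *)
Definition hyperbolic : Prop :=
  forall z : algC, eigenvalue (map_mx ratr lfun_mx) z -> `|z| != 1.

Definition integral_unit_char_poly : Prop :=
  let p := char_poly lfun_mx in
  p \is a polyOver Num.int /\ (p`_0 = 1 \/ p`_0 = -1).

End Automorphisms.

(* Main.v *)
Require Import Defs.
From HB Require Import structures.
From mathcomp Require Import all_boot all_order all_algebra all_field.
From mathcomp Require Import ring zify.

(** Let f be such an automorphism and A its action on the abelianization of M,
    so that A lifts to the degree-three part of Q and fixes the line spanned
    by X, with a rational eigenvalue mu.  A power B of A preserves all the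
    subspaces spanned by up-sets of the preorder N(i) <= N[j] on vertices, and
    over algC a change of basis inside each equivalence class of vertices makes
    B triangular with diagonal entries w i.  The degree-three part is then
    filtered by multidegree, with graded pieces on which B acts by w i w j w k.
    As X spans the only part of the spectrum of B that is allowed to meet the
    unit circle, mu = w i w j w k for some path i - j - k; mu is a rational
    unit, so it is 1 or -1, and (i, j, k) is up to order the only path of
    unimodular weight, with a graded piece of dimension one.  The multiset of the
    w i over each class is Galois-stable and no w i is rational, for a rational
    unit has modulus one; so a Galois conjugate of (i, j, k) is another
    unimodular path, a contradiction. *)

Set Implicit Arguments.
Unset Strict Implicit.
Unset Printing Implicit Defensive.

Import Order.TTheory GRing.Theory Num.Theory.
Local Open Scope ring_scope.

(** * Eigenvectors and eigenvalues *)

(* The functional l exhibits w as an eigenvalue of the transpose of T on the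
   cyclic subspace generated by v0; hence T - w cannot be injective there. *)
Lemma eigenvector_of_functional (K : fieldType) (V : vectType K) (T : 'End(V))
    (P : V -> Prop) (l : V -> K) (w : K) (v0 : V) :
  (forall a x y, P x -> P y -> P (a *: x + y)) ->
  (forall x, P x -> P (T x)) ->
  (forall a x y, l (a *: x + y) = a * l x + l y) ->
  (forall x, P x -> l (T x) = w * l x) ->
  P v0 -> l v0 != 0 -> exists v, [/\ P v, v != 0 & T v = w *: v].
Proof.
move=> PD PT lD lT Pv0 lv0.
pose F (U : {vspace V}) := (U + T @: U)%VS.
pose U := iter (dim V) F <[v0]>%VS.
have FU : F U = U by apply: iter_fixed => W; apply: addvSl.
have v0U : v0 \in U.
  by rewrite (subvP (@iter_subv _ _ F (fun W => addvSl _ _) _ _)) // memv_line.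
have P0 : P 0 by have := PD (-1) _ _ Pv0 Pv0; rewrite scaleN1r addNr.
have PU x : x \in U -> P x.
  rewrite /U; elim: (dim V) x => [|m IH] /= x.
    by case/vlineP=> a ->; rewrite -[_ *: _]addr0; apply: PD.
  case/memv_addP=> y yU [_ /memv_imgP[z zU ->] ->].
  by rewrite -[y]scale1r; apply: PD; [apply: IH|apply/PT/IH].
have TU x : x \in U -> T x \in U.
  by move=> xU; rewrite -FU (subvP (addvSr _ _)) // memv_img.
pose G := (T - w *: \1)%VF.
have GE x : G x = T x - w *: x by rewrite add_lfunE opp_lfunE scale_lfunE id_lfunE.
have [/eqP kU|kU] := boolP (U :&: lker G == 0)%VS; last first.
  exists (vpick (U :&: lker G)); have := memv_pick (U :&: lker G)%VS.
  rewrite memv_cap memv_ker GE subr_eq0 vpick0 => /andP[uU /eqP Tu].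
  by split=> //; apply: PU.
have GU : (G @: U <= U)%VS.
  apply/subvP=> _ /memv_imgP[x xU ->].
  by rewrite GE memvB ?TU ?memvZ.
have /eqP EU : (G @: U == U)%VS by rewrite eqEdim GU limg_dim_eq /=.
move: v0U; rewrite -EU => /memv_imgP[u uU v0E].
have : l v0 = 0.
  have -> : v0 = (- w) *: u + T u by rewrite v0E GE scaleNr addrC.
  by rewrite lD lT; [rewrite mulNr addNr|apply: PU].
by move/eqP: lv0.
Qed.

Lemma eigenvalue_of_power m (F : 'M[algC]_m) (k : nat) (z : algC) (v : 'rV_m) :
  v != 0 -> iter k (mulmxr F) v = z *: v ->
  exists2 y, eigenvalue F y & y ^+ k = z.
Proof.
case: m F v => [|m] F v v0 vF.
  by case/eqP: v0; apply/rowP=> -[].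
have iterE j (u : 'rV_m.+1) : iter j (mulmxr F) u = u *m F ^+ j.
  elim: j => [|j IH]; first by rewrite expr0 mulmx1.
  by rewrite iterS IH /= -mulmxA exprSr.
rewrite iterE in vF.
pose E := eigenspace (F ^+ k) z.
have E0 : E != 0.
  apply: contraNneq v0 => E0; have : (v <= E)%MS by apply/eigenspaceP.
  by rewrite E0 submx0.
have comm : comm_mx F (F ^+ k) by rewrite /comm_mx -[LHS]exprS exprSr.
have sE : stablemx E F by apply: comm_mx_stable_eigenspace; apply/esym.
pose R := restrictmx E F.
have [|a aR] := @spectral.eigenvalue_closed _ _ R; first by rewrite lt0n mxrank_eq0.
have /eigenvalueP[u uR u0] := aR.
have tE : (u *m row_base E <= eigenspace F a)%MS.
  by rewrite -sub_eigenspace_conjmx ?stablemx_row_base ?row_base_free //; apply/eigenspaceP.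
set t := u *m row_base E in tE.
have t0 : t != 0 by rewrite mulmx_free_eq0 ?row_base_free.
exists a; first by apply/eigenvalueP; exists t => //; apply/eigenspaceP.
have tz : t *m F ^+ k = z *: t.
  by apply/eigenspaceP; rewrite (submx_trans (submxMl _ _)) // eq_row_base.
have ta : t *m F ^+ k = a ^+ k *: t.
  rewrite -iterE; elim: (k) => [|j IH]; first by rewrite expr0 scale1r.
  by rewrite iterS IH /= -scalemxAl (eigenspaceP tE) scalerA exprSr.
apply/eqP; rewrite -subr_eq0; have /eqP := tz; rewrite ta -subr_eq0 -scalerBl.
by rewrite scaler_eq0 (negPf t0) orbF.
Qed.

Lemma minCpoly_other_root (b : algC) :
  b \notin Crat -> exists2 c, root (minCpoly b) c & c != b.
Proof.
move=> bQ; have [q [Dq q_monic] min_q] := minCpolyP b.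
have [r Dp] := closed_field_poly_normal (minCpoly b).
rewrite (monicP (minCpoly_monic b)) scale1r in Dp.
have [/allP rb|/allPn[c cr cb]] := boolP (all (pred1 b) r); last first.
  by exists c => //; rewrite Dp root_prod_XsubC.
case/negP: bQ; have {rb}Er : r = nseq (size r) b by apply/all_pred1P/allP.
have r0 : size r != 0%N.
  have := root_minCpoly b; rewrite Dp; case: (r) => //.
  by rewrite big_nil (negPf (root1 _)).
have Es : \sum_(z <- r) z = b *+ size r.
  by rewrite {1}Er big_nseq iter_addr_0.
have := coefPn_prod_XsubC r0; rewrite -Dp Dq coef_map /= Es => /esym/eqP.
rewrite eqr_oppLR -mulr_natr => /eqP Eb.
have -> : b = (- ratr q`_(size r).-1) / (size r)%:R.
  by rewrite -Eb mulfK // pnatr_eq0.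
by rewrite rpred_div ?rpredN ?Crat_rat ?rpred_nat.
Qed.

Lemma conj_root_aut (b c : algC) :
  root (minCpoly b) c -> exists s : {rmorphism algC -> algC}, s b = c.
Proof.
move=> bc; have [q [Dq q_monic] min_q] := minCpolyP b.
have [r Dp] := closed_field_poly_normal (minCpoly b).
rewrite (monicP (minCpoly_monic b)) scale1r in Dp.
have [Qn [QnC [rr Drr genQn]]] := num_field_exists r.
have rP z : root (minCpoly b) z -> exists2 zn, zn \in rr & QnC zn = z.
  by rewrite Dp root_prod_XsubC -Drr => /mapP[zn ? ->]; exists zn.
have [bn bnr Db] := rP _ (root_minCpoly b); have [cn cnr Dc] := rP _ bc.
pose phi := kHomExtend 1 \1 bn cn.
have homQn1: kHom 1 1 (\1%VF : 'End(Qn)) by rewrite kHom1.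
have pbn_c: root (map_poly \1%VF (minPoly 1 bn)) cn.
  rewrite -(fmorph_root QnC) Dc -map_poly_comp.
  rewrite (@eq_map_poly _ _ _ QnC) => [|a]; last by rewrite /= id_lfunE.
  set p1 := map_poly _ _.
  have [q1 Dp1]: exists q1, p1 = map_poly ratr q1.
    have aP i: (minPoly 1 bn)`_i \in 1%VS.
      by apply/polyOverP; apply: minPolyOver.
    have{aP} a_ i := sig_eqW (vlineP _ _ (aP i)).
    exists (\poly_(i < size (minPoly 1 bn)) sval (a_ i)).
    apply/polyP=> i; rewrite coef_poly coef_map coef_poly /=.
    case: ifP => _; rewrite ?rmorph0 //; case: (a_ i) => a /= ->.
    by rewrite alg_num_field fmorph_rat.
  have: root p1 b by rewrite -Db fmorph_root root_minPoly.
  rewrite Dp1 min_q => /dvdpP[r1 ->].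
  by rewrite rmorphM rootM /= -Dq bc orbT.
have hom_phi : kHom 1 <<1; bn>> phi by rewrite kHomExtendP.
pose pr := map_poly (in_alg Qn) q.
have Qpr: pr \is a polyOver 1%VS.
  by apply/polyOverP=> i; rewrite coef_map memvZ ?memv_line.
have split: splittingFieldFor <<1; bn>> pr fullv.
  apply: (@splittingFieldForS _ _ 1) => //; [exact: subv_adjoin|exact: subvf|].
  exists rr => //; congr (_ %= _): (eqpxx pr); apply/(map_poly_inj QnC).
  rewrite rmorph_prod /= -map_poly_comp (eq_map_poly (fmorph_eq_rat _)) -Dq Dp -Drr big_map.
  by apply: eq_bigr => zz _; rewrite map_polyXsubC.
have [f1 aut_f1 Df1]:= kHom_extends (sub1v _) hom_phi Qpr split.
pose f1mM := GRing.isMonoidMorphism.Build _ _ f1 (kHom_monoid_morphism aut_f1).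
pose f1R : {rmorphism _ -> _} := HB.pack (fun_of_lfun f1) f1mM.
have [nu Dnu] := extend_algC_subfield_aut QnC f1R.
exists nu; rewrite -Db -Dnu /= -Df1 ?memv_adjoin //.
by rewrite /phi (kHomExtend_val homQn1).
Qed.

Lemma aut_moving (b : algC) :
  b \notin Crat -> exists s : {rmorphism algC -> algC}, s b != b.
Proof.
move=> /minCpoly_other_root[c bc cb]; have [s sb] := conj_root_aut bc.
by exists s; rewrite sb.
Qed.

Section EigenvaluesOfEndomorphisms.
Variables (M : vectLieType rat) (f : 'End(M)).
Local Notation F := (map_mx (ratr : rat -> algC) (lfun_mx f)).

Lemma eigenvalue_of_functional (psi : M -> algC) (k : nat) (z : algC) (x0 : M) :
  (forall a x y, psi (a *: x + y) = ratr a * psi x + psi y) ->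
  (forall j, psi (iter k f (iter j f x0)) = z * psi (iter j f x0)) ->
  psi x0 != 0 -> exists2 y, eigenvalue F y & y ^+ k = z.
Proof.
move=> psiD psi_z psi0; pose e := vbasis {:M}.
pose r (x : M) : 'rV[algC]_(\dim {:M}) := map_mx ratr (passmx.rVof e x).
pose Psi : 'cV[algC]_(\dim {:M}) := \col_i psi e`_i.
have rf x : r (f x) = r x *m F.
  by rewrite /r /lfun_mx -map_mxM (passmx.rVof_app (e := e)) ?vbasisP.
have psi_0 : psi 0 = 0.
  by have := psiD (-1) 0 0; rewrite scaler0 addr0 raddfN /= rmorph1 mulN1r addNr.
have psi_sum (I : Type) (s : seq I) (c : I -> rat) (v : I -> M) :
    psi (\sum_(i <- s) c i *: v i) = \sum_(i <- s) ratr (c i) * psi (v i).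
  by elim: s => [|i s IH]; rewrite ?big_nil // !big_cons psiD IH.
have rPsi x : (r x *m Psi) 0 0 = psi x.
  rewrite {2}(coord_vbasis (memvf x)) psi_sum !mxE; apply: eq_bigr => i _.
  by rewrite !mxE.
pose G := iter k (mulmxr F) 1%:M.
have GE v : iter k (mulmxr F) v = v *m G :> 'rV_(\dim {:M}).
  rewrite /G; elim: k {psi_z G} => [|k IH] /=; first by rewrite mulmx1.
  by rewrite IH mulmxA.
have rk j x : r (iter j f x) = iter j (mulmxr F) (r x).
  by elim: j => //= j IH; rewrite rf IH.
pose P (v : 'rV[algC]_(\dim {:M})) := forall j, iter k (mulmxr F) (iter j (mulmxr F) v) *m Psi
                        = z *: (iter j (mulmxr F) v *m Psi).
have itD j a (u v : 'rV[algC]_(\dim {:M})) :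
  iter j (mulmxr F) (a *: u + v) = a *: iter j (mulmxr F) u + iter j (mulmxr F) v.
  by elim: j => //= j ->; rewrite mulmxDl scalemxAl.
have [||||||v [Pv v0 Tv]] := @eigenvector_of_functional _ _
    (linfun (mulmxr G : 'rV[algC]_(\dim {:M}) -> 'rV[algC]_(\dim {:M})))
    P (fun v => (v *m Psi) 0 0) z (r x0).
- move=> a x y Px Py j; rewrite !itD !mulmxDl -!scalemxAl Px Py scalerDr !scalerA.
  by rewrite mulrC.
- move=> x Px j; rewrite lfunE /= -GE.
  have it2 u : iter j (mulmxr F) (iter k (mulmxr F) u) =
      iter k (mulmxr F) (iter j (mulmxr F) u).
    by rewrite -!iterD addnC.
  rewrite it2; have := Px (k + j)%N; rewrite iterD; exact.
- by move=> a x y; rewrite mulmxDl -scalemxAl !mxE.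
- by move=> x Px; rewrite lfunE /= -GE; have /= -> := Px 0%N; rewrite mxE.
- move=> j; rewrite -!rk; apply/matrixP=> a b; rewrite !ord1 rPsi psi_z.
  by rewrite mxE rPsi.
- by rewrite rPsi.
by apply: (eigenvalue_of_power v0); rewrite GE -Tv lfunE.
Qed.

Lemma eigenvalue_unit (y : algC) : integral_unit_char_poly f ->
  eigenvalue F y -> [/\ y != 0, y \in Aint & y^-1 \in Aint].
Proof.
case=> pZ p0; rewrite eigenvalue_root_char -map_char_poly; set p := char_poly _ in pZ p0 *.
have pZ' : map_poly (ratr : rat -> algC) p \is a polyOver Num.int.
  apply/polyOverP=> i; rewrite coef_map; have /intrP[m ->] := polyOverP pZ i.
  by rewrite /= ratr_int intr_int.
move=> py; have yA : y \in Aint.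
  by apply: root_monic_Aint py _ pZ'; rewrite monic_map ?char_poly_monic.
have [q qZ H] : exists2 q, q \is a polyOver Num.int &
    map_poly ratr p = q * 'X + (ratr p`_0)%:P :> {poly algC}.
  exists (\poly_(i < (size p).-1) (ratr p`_i.+1)).
    apply/polyOverP=> i; rewrite coef_poly; case: ifP => _; last exact: rpred0.
    by have := polyOverP pZ' i.+1; rewrite coef_map.
  apply/polyP=> -[|i]; rewrite coefD coefMX coefC coef_map //= ?add0r ?addr0 //.
  rewrite coef_poly; case: ltnP => // sz.
  by rewrite nth_default ?rmorph0 //; case: (size p) sz.
have qA : q.[y] \in Aint.
  apply: rpred_horner => //; apply: polyOverS qZ => x; exact: Aint_Cint.
have y0 : y != 0.
  move: py => /rootP; rewrite H => + ; apply: contra_eqN => /eqP ->.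
  rewrite !hornerE; case: p0 => ->; by rewrite ?rmorphN rmorph1 ?oppr_eq0 oner_eq0.
have E : q.[y] * y = - ratr p`_0.
  by apply/eqP; rewrite -addr_eq0; move/rootP: py; rewrite H !hornerE => ->.
split=> //; case: p0 => E0; rewrite E0 ?rmorphN rmorph1 in E.
  have -> : y^-1 = - q.[y] by apply: (mulIf y0); rewrite mulVf // mulNr E opprK.
  by rewrite rpredN.
by have -> : y^-1 = q.[y] by apply: (mulIf y0); rewrite mulVf // E opprK.
Qed.

End EigenvaluesOfEndomorphisms.

(** * The vicinal preorder of a graph and its incidence algebra *)

Section Vicinal.
Variables (n : nat) (e : rel 'I_n).
Hypotheses (e_sym : symmetric e) (e_irr : irreflexive e).
Implicit Types i j k : 'I_n.

Definition dom i j := [forall k, e i k ==> (k == j) || e j k].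

Lemma domP i j : reflect (forall k, e i k -> k = j \/ e j k) (dom i j).
Proof.
apply: (iffP forallP) => [H k ik|H k]; last first.
  by apply/implyP=> /H[->|->]; rewrite ?eqxx ?orbT.
by have := H k; rewrite ik => /orP[/eqP|]; [left|right].
Qed.

Lemma dom_refl : reflexive dom.
Proof. by move=> i; apply/domP=> k ik; right. Qed.

Lemma dom_trans : transitive dom.
Proof.
move=> b a c /domP ab /domP bc; apply/domP=> x ax.
have [xb|/bc //] := ab _ ax; move: ax; rewrite {x}xb => ax.
have /bc[ac|ca] : e b a by rewrite e_sym.
  by right; rewrite -ac.
by have [|cb|eb] := ab c; [rewrite e_sym|left|right; rewrite e_sym].
Qed.

Lemma dom_edge i i' j j' : dom i i' -> dom j j' -> e i j -> i' = j' \/ e i' j'.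
Proof.
move=> /domP ii' /domP jj' ij.
have [ji'|i'j] := ii' _ ij.
  have [|ij'|j'i] := jj' i; first by rewrite e_sym.
    by right; rewrite -ji' -ij' e_sym.
  have [|j'i'|] := ii' j'; [by rewrite e_sym|by left|by right].
have [|i'j'|j'i'] := jj' i'; [by rewrite e_sym|by left|by right; rewrite e_sym].
Qed.

Definition block i j := dom i j && dom j i.

Lemma block_sym : symmetric block.
Proof. by move=> i j; rewrite /block andbC. Qed.

Lemma block_trans : transitive block.
Proof.
move=> j i k /andP[ij ji] /andP[jk kj].
by rewrite /block (dom_trans ij jk) (dom_trans kj ji).
Qed.

Lemma block_edge i i' j j' : block i i' -> block j j' -> i' != j' -> e i j -> e i' j'.
Proof.
move=> /andP[ii' _] /andP[jj' _] nij ij.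
by have [eij|//] := dom_edge ii' jj' ij; rewrite eij eqxx in nij.
Qed.

Section Incidence.
Variable K : comNzRingType.
Implicit Types M N : 'M[K]_n.

Definition incidence M := forall i j, M i j != 0 -> dom i j.

Lemma incidenceM M N : incidence M -> incidence N -> incidence (M *m N).
Proof.
move=> PM PN i j; apply: contraNT => nij; rewrite mxE big1 // => k _.
have [->|/PM ik] := eqVneq (M i k) 0; first by rewrite mul0r.
have [->|/PN kj] := eqVneq (N k j) 0; first by rewrite mulr0.
by rewrite (dom_trans ik kj) in nij.
Qed.

End Incidence.

Implicit Types M N A w : 'M[rat]_n.

(* M preserves the kernel of the bracket from bivectors to degree two. *)
Definition bracket_compat (M : 'M[rat]_n) :=
  forall i i' j j', e i i' -> ~~ e j j' -> M i j * M i' j' = M i j' * M i' j.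

Definition nonedge_bivector (w : 'M[rat]_n) :=
  (forall i j, w i j = - w j i) /\ (forall i j, e i j -> w i j = 0).

Definition nonedge_stable (M : 'M[rat]_n) :=
  forall w, nonedge_bivector w -> nonedge_bivector (M *m w *m M^T).

Lemma nonedge_stableM M N : nonedge_stable M -> nonedge_stable N -> nonedge_stable (M *m N).
Proof.
by move=> sM sN w /sN /sM; rewrite trmx_mul !mulmxA.
Qed.

Lemma nonedge_stable1 : nonedge_stable 1%:M.
Proof. by move=> w; rewrite trmx1 mulmx1 mul1mx. Qed.

Lemma conj_bivectorE M w i j :
  (M *m w *m M^T) i j = \sum_a \sum_b M i a * w a b * M j b.
Proof.
rewrite mxE exchange_big /=; apply: eq_bigr => b _.
by rewrite !mxE big_distrl.
Qed.

Lemma conj_bivector_skew M w : (forall i j, w i j = - w j i) ->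
  forall i j, (M *m w *m M^T) i j = - (M *m w *m M^T) j i.
Proof.
move=> sk i j; rewrite !conj_bivectorE exchange_big /= -sumrN.
apply: eq_bigr => a _; rewrite -sumrN; apply: eq_bigr => b _.
by rewrite sk mulrN mulNr mulrAC [_ * M j a]mulrC mulrAC.
Qed.

Lemma bracket_compat_nonedge_stable M : bracket_compat M -> nonedge_stable M.
Proof.
move=> cM w [sk w0]; have sk' := conj_bivector_skew M sk.
split=> // i j ij; suff /eqP: (M *m w *m M^T) i j *+ 2 = 0 by rewrite mulrn_eq0 => /eqP.
rewrite mulr2n {2}sk' !conj_bivectorE -sumrB.
rewrite big1 // => a _; rewrite -sumrB big1 // => b _.
have [/w0->|ab] := boolP (e a b); first by rewrite !mulr0 !mul0r subr0.
have H := cM _ _ _ _ ij ab.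
transitivity (w a b * (M i a * M j b - M i b * M j a)); first by ring.
by rewrite H subrr mulr0.
Qed.

(* Conjugating the diagonal idempotent at i by A gives a derivation of the
   degree-two part, and such derivations lie in the incidence algebra. *)
Lemma nonedge_stable_rank1 A A' : nonedge_stable A -> nonedge_stable A' -> A *m A' = 1%:M ->
  forall u i v, A u i != 0 -> A' i v != 0 -> dom u v.
Proof.
move=> sA sA' AA' u i v ui iv; apply/domP=> x ux.
have [->|xv] := eqVneq x v; [by left|right].
apply: contraTT (isT) => vx.
pose w0 : 'M[rat]_n := delta_mx v x - delta_mx x v.
pose D : 'M[rat]_n := delta_mx i i.
pose C := A *m D *m A'.
have Nw0 : nonedge_bivector w0.
  split=> a b; rewrite !mxE.
    by rewrite opprB [(a == x) && _]andbC [(a == v) && _]andbC.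
  move=> ab.
  have -> : (a == v) && (b == x) = false.
    by apply: contraNF vx => /andP[/eqP<- /eqP<-].
  have -> : (a == x) && (b == v) = false.
    by apply: contraNF vx => /andP[/eqP<- /eqP<-]; rewrite e_sym.
  by rewrite subr0.
have Nder w : nonedge_bivector w -> nonedge_bivector (D *m w + w *m D^T).
  move=> [sk w_0]; have DE a b : (D *m w + w *m D^T) a b = ((a == i)%:R + (b == i)%:R) * w a b.
    rewrite !mxE mulrDl; congr (_ + _).
      rewrite (bigD1 i) //= big1 ?addr0 => [|c ci]; rewrite !mxE ?eqxx ?andbT.
        by case: eqP => [->|_] //; rewrite !mul0r.
      by rewrite (negPf ci) andbF mul0r.
    rewrite (bigD1 i) //= big1 ?addr0 => [|c ci]; rewrite !mxE ?eqxx ?andbT.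
      by case: eqP => [->|_]; rewrite ?mulr1 ?mul1r ?mulr0 ?mul0r.
    by rewrite (negPf ci) andbF mulr0.
  split=> a b; rewrite !DE; first by rewrite sk mulrN [_%:R + _]addrC.
  by move=> /w_0->; rewrite mulr0.
have [_ /(_ u x ux)] := sA _ (Nder _ (sA' _ Nw0)).
have -> : A *m (D *m (A' *m w0 *m A'^T) + A' *m w0 *m A'^T *m D^T) *m A^T
    = C *m w0 + w0 *m C^T.
  have AA'T : A'^T *m A^T = 1%:M by rewrite -trmx_mul AA' trmx1.
  rewrite mulmxDr mulmxDl /C !trmx_mul !mulmxA AA' mul1mx; congr (_ + _).
  by rewrite -[X in X = _]mulmxA AA'T mulmx1.
have uv : u != v by apply: contraNneq vx => <-.
have xu : x != u by apply: contraTneq ux => ->; rewrite e_irr.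
have CE : C u v = A u i * A' i v.
  rewrite mxE (bigD1 i) //= big1 ?addr0 => [|c ci]; rewrite !mxE.
    rewrite (bigD1 i) //= big1 ?addr0 => [|c ci]; rewrite !mxE ?eqxx ?mulr1 //.
    by rewrite (negPf ci) mulr0.
  rewrite big1 ?mul0r // => d _; by rewrite mxE (negPf ci) andbF mulr0.
clearbody C; rewrite mxE => /eqP; rewrite !mxE (bigD1 v) //= big1 ?addr0 => [|c cv]; last first.
  by rewrite !mxE (negPf cv) (negPf xv) andbF subr0 mulr0.
rewrite big1 ?addr0 => [|c _]; last first.
  by rewrite !mxE (negPf uv) [u == x]eq_sym (negPf xu) subr0 mul0r.
rewrite !mxE !eqxx [v == x]eq_sym (negPf xv) subr0 mulr1.
by rewrite CE mulf_eq0 (negPf ui) (negPf iv).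
Qed.

Lemma power_in_incidence A A' : nonedge_stable A -> nonedge_stable A' -> A *m A' = 1%:M ->
  exists2 k : nat, (0 < k)%N & incidence (iter k (mulmx A) 1%:M).
Proof.
move=> sA sA' AA'.
pose pw (M : 'M[rat]_n) (k : nat) := iter k (mulmx M) 1%:M.
have pwD M (i j : nat) : pw M (i + j)%N = pw M i *m pw M j.
  rewrite /pw; elim: i => [|i IH]; first by rewrite mul1mx.
  by rewrite addSn !iterS IH mulmxA.
have pwC M (i : nat) : pw M i *m M = pw M i.+1.
  by rewrite -addn1 pwD /pw /= mulmx1.
have pwV (i : nat) : pw A i *m pw A' i = 1%:M.
  elim: i => [|i IH]; first by rewrite mulmx1.
  by rewrite -pwC [pw A' _]iterS -mulmxA (mulmxA A) AA' mul1mx IH.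
have spw M (i : nat) : nonedge_stable M -> nonedge_stable (pw M i).
  by move=> sM; elim: i => [|i IH]; [exact: nonedge_stable1|exact: nonedge_stableM].
pose pat (k : nat) := [set p | pw A k p.1 p.2 != 0].
have [i [j [ij Ep]]] : exists i j : nat, (i < j)%N /\ pat i = pat j.
  pose N := #|{set 'I_n * 'I_n}|.
  pose g (i : 'I_N.+1) := pat i.
  have /injectivePn[x [y xy gxy]] : ~~ injectiveb g.
    by apply/negP=> /injectiveP /leq_card; rewrite card_ord ltnn.
  have [lt|lt|eq] := ltngtP x y; [by exists x, y|by exists y, x|].
  by case/eqP: xy; apply: val_inj.
exists (j - i)%N; first by rewrite subn_gt0.
move=> u v uv.
have Ej : pw A (j - i)%N = pw A j *m pw A' i.
  by rewrite -(subnK (ltnW ij)) pwD -mulmxA pwV mulmx1 addnK.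
have {}uv : \sum_k pw A j u k * pw A' i k v != 0 by move: uv; rewrite -/(pw A (j - i)%N) Ej mxE.
have [k uk] : exists k, pw A j u k * pw A' i k v != 0.
  by apply/existsP; apply: contraNT uv => /existsPn H; rewrite big1 // => k _; apply/eqP/negPn/H.
move: uk; rewrite mulf_eq0 negb_or => /andP[uk kv].
have {}uk : pw A i u k != 0.
  by have : (u, k) \in pat i; [rewrite Ep inE|rewrite inE].
exact: (nonedge_stable_rank1 (spw _ i sA) (spw _ i sA') (pwV i) uk kv).
Qed.

End Vicinal.

(** * Blockwise triangularization *)

Lemma trigonalization_exists m (D : 'M[algC]_m) :
  exists P : 'M[algC]_m, (P \in unitmx) && is_trig_mx (P *m D *m invmx P).
Proof.
case: (posnP m) => [m0|m0].
  exists 1%:M; rewrite unitmx1; apply/is_trig_mxP=> -[i im].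
  by exfalso; rewrite m0 in im.
have [P PU PT] := spectral.Schur D m0; exists P.
by rewrite -conjumx ?spectral.unitarymx_unit.
Qed.

Lemma eigenvalue_trig_diag m (D P : 'M[algC]_m) :
  P \in unitmx -> is_trig_mx (P *m D *m invmx P) ->
  forall z, eigenvalue D z <-> exists a, (P *m D *m invmx P) a a = z.
Proof.
move=> Pu Pt z.
have -> : eigenvalue D z = eigenvalue (P *m D *m invmx P) z.
  rewrite -conjumx //; apply/idP/idP; last first.
    by apply: eigenvalue_conjmx; rewrite ?stablemx_unit ?row_free_unit.
  rewrite -{1}[D](conjmxK _ Pu).
  by apply: eigenvalue_conjmx; rewrite ?stablemx_unit ?row_free_unit ?unitmx_inv.
rewrite eigenvalue_root_char char_poly_trig //.
rewrite -(big_map (fun a => (P *m D *m invmx P) a a) xpredT (fun w => 'X - w%:P)).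
rewrite root_prod_XsubC; split=> [/mapP[a _ ->]|[a <-]]; first by exists a.
by apply/mapP; exists a; rewrite ?mem_index_enum.
Qed.

Section Triangularization.
Variables (n : nat) (e : rel 'I_n).
Hypothesis e_sym : symmetric e.
Variable B : 'M[rat]_n.
Hypothesis PB : incidence e B.

Local Notation BK := (map_mx (ratr : rat -> algC) B).

Let cls i := [set j | block e i j].

Let sel (c : {set 'I_n}) : 'M[algC]_(#|c|, n) := rowsub enum_val 1%:M.

Let sel_sub (c : {set 'I_n}) (M : 'M[algC]_n) a b :
  (sel c *m M *m (sel c)^T) a b = M (enum_val a) (enum_val b).
Proof.
rewrite /sel mul_rowsub_mx mul1mx mxE (bigD1 (enum_val b)) //= !mxE eqxx mulr1.
rewrite big1 ?addr0 // => j jb; rewrite !mxE eq_sym (negPf jb) mulr0 //.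
Qed.

Let selK (c : {set 'I_n}) : sel c *m (sel c)^T = 1%:M.
Proof.
by apply/matrixP=> a b; rewrite -{1}[sel c]mulmx1 sel_sub !mxE (inj_eq enum_val_inj).
Qed.


Let blocks := [set cls i | i : 'I_n].

Let mem_cls i : i \in cls i.
Proof. by rewrite inE /block dom_refl. Qed.

Let block_cls i j : block e i j -> cls i = cls j.
Proof.
move=> ij; apply/setP=> k; rewrite !inE; apply/idP/idP.
  by apply: block_trans => //; rewrite block_sym.
exact: block_trans.
Qed.

Let cls_blocks i : cls i \in blocks.
Proof. exact: imset_f. Qed.

Let blocksP c i : c \in blocks -> i \in c -> c = cls i.
Proof. by case/imsetP=> k _ ->; rewrite inE => /block_cls. Qed.

Let sel_disjoint c d : c \in blocks -> d \in blocks -> c != d ->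
  sel c *m (sel d)^T = 0.
Proof.
move=> cb db cd; apply/matrixP=> a b; rewrite mxE big1 ?mxE // => k _.
rewrite !mxE; case: eqP => [ak|_]; last by rewrite mul0r.
case: eqP => [bk|_]; last by rewrite mulr0.
case/eqP: cd; rewrite (blocksP cb (enum_valP a)) (blocksP db (enum_valP b)).
by rewrite ak bk.
Qed.

Let glue (Q : forall c : {set 'I_n}, 'M[algC]_#|c|) : 'M[algC]_n :=
  \sum_(c in blocks) (sel c)^T *m Q c *m sel c.

Let sel_glue Q c : c \in blocks -> sel c *m glue Q = Q c *m sel c.
Proof.
move=> cb; rewrite mulmx_sumr (bigD1 c) //= big1 ?addr0 => [|d /andP[db dc]].
  by rewrite !mulmxA selK mul1mx.
by rewrite !mulmxA sel_disjoint ?mul0mx // eq_sym.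
Qed.

Let glue_sel Q c : c \in blocks -> glue Q *m (sel c)^T = (sel c)^T *m Q c.
Proof.
move=> cb; rewrite mulmx_suml (bigD1 c) //= big1 ?addr0 => [|d /andP[db dc]].
  by rewrite -mulmxA selK mulmx1.
by rewrite -mulmxA sel_disjoint ?mulmx0.
Qed.

Let sel_row c (M : 'M[algC]_n) a j : (sel c *m M) a j = M (enum_val a) j.
Proof. by rewrite mul_rowsub_mx mul1mx mxE. Qed.

Let in_cls i : exists a : 'I_#|cls i|, enum_val a = i.
Proof.
by exists (enum_rank_in (mem_cls i) i); rewrite enum_rankK_in ?mem_cls.
Qed.

Let glue_incidence Q : incidence e (glue Q).
Proof.
move=> i j; have [a ai] := in_cls i; rewrite -{1}ai -sel_row sel_glue //.
apply: contraNT => nij; rewrite mxE big1 // => b _; rewrite mxE mxE.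
case: eqP => [bj|_]; last by rewrite mulr0.
by have := enum_valP b; rewrite bj inE => /andP[ij]; rewrite ij in nij.
Qed.

Let P (c : {set 'I_n}) : 'M[algC]_#|c| := xchoose (trigonalization_exists (sel c *m BK *m (sel c)^T)).
Let P_unit (c : {set 'I_n}) : P c \in unitmx.
Proof. by have /andP[] := xchooseP (trigonalization_exists (sel c *m BK *m (sel c)^T)). Qed.
Let P_trig (c : {set 'I_n}) : is_trig_mx (P c *m (sel c *m BK *m (sel c)^T) *m invmx (P c)).
Proof. by have /andP[] := xchooseP (trigonalization_exists (sel c *m BK *m (sel c)^T)). Qed.

Let g := glue P.
Let g' := glue (fun c => invmx (P c)).

Let glueV Q Q' : (forall c, Q c *m Q' c = 1%:M) -> glue Q *m glue Q' = 1%:M.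
Proof.
move=> QQ'; apply/matrixP=> i j; have [a ai] := in_cls i.
rewrite -{1 2}ai -!sel_row mulmxA sel_glue // -mulmxA sel_glue //.
by rewrite mulmxA QQ' mul1mx mulmx1.
Qed.

Let B' := g *m BK *m g'.

Let B'_block (c : {set 'I_n}) (a b : 'I_#|c|) : c \in blocks -> B' (enum_val a) (enum_val b) =
  (P c *m (sel c *m BK *m (sel c)^T) *m invmx (P c)) a b.
Proof.
move=> cb; rewrite -sel_sub /B' !mulmxA sel_glue // -!mulmxA glue_sel //.
Qed.

Let B'_incidence : incidence e B'.
Proof.
do 2?apply: incidenceM => //; try exact: glue_incidence.
by move=> i j; rewrite mxE fmorph_eq0; apply: PB.
Qed.

Let height i := #|[set j | dom e j i]|.

Let height_lt i j : dom e i j -> ~~ dom e j i -> (height i < height j)%N.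
Proof.
move=> ij ji; apply: proper_card; apply/properP; split.
  by apply/subsetP=> k; rewrite !inE => ki; apply: dom_trans ij.
by exists j; rewrite !inE ?dom_refl.
Qed.

Let height_eq i j : block e i j -> height i = height j.
Proof.
case/andP=> ij ji; apply: eq_card => k; rewrite !inE.
by apply/idP/idP=> h; [apply: dom_trans ij|apply: dom_trans ji].
Qed.

Let pos i := index i (enum (cls i)).

Let pos_lt i : (pos i < n.+1)%N.
Proof.
rewrite ltnS (leq_trans (index_size _ _)) // -cardE.
by rewrite (leq_trans (max_card _)) ?card_ord.
Qed.

Let radix_lt a b r s m : (r < m)%N -> (a < b)%N -> (a * m + r < b * m + s)%N.
Proof. by move=> rm ab; nia. Qed.

(* h sorts the vertices by height, then by class, and inside a class backwards,
   since Schur's theorem produces lower triangular matrices. *)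
Let N := #|{set 'I_n}|.
Let key i := (height i * N + enum_rank (cls i))%N.
Let h i := (key i * n.+1 + (n - pos i))%N.

Let key_lt i j : (key i < key j)%N -> (h i < h j)%N.
Proof. by move=> ij; apply: radix_lt => //; rewrite ltnS leq_subr. Qed.

Let key_eq i j : key i = key j -> cls i = cls j.
Proof.
move=> kij; apply/enum_rank_inj/val_inj => /=.
have [hij|hij|hij] := ltngtP (height i) (height j).
- have := radix_lt (enum_rank (cls j)) (ltn_ord (enum_rank (cls i))) hij.
  by rewrite -/(key i) -/(key j) kij ltnn.
- have := radix_lt (enum_rank (cls i)) (ltn_ord (enum_rank (cls j))) hij.
  by rewrite -/(key i) -/(key j) kij ltnn.
- by move: kij; rewrite /key hij => /addnI.
Qed.

Let pos_inj i j : cls i = cls j -> pos i = pos j -> i = j.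
Proof.
move=> cij pij; rewrite -(nth_index i (_ : i \in enum (cls i))) ?mem_enum //.
by rewrite -/(pos i) pij /pos cij nth_index // mem_enum.
Qed.

Let h_inj : injective h.
Proof.
move=> i j hij; have [kij|kij|kij] := ltngtP (key i) (key j).
- by have := key_lt kij; rewrite hij ltnn.
- by have := key_lt kij; rewrite hij ltnn.
- apply: pos_inj (key_eq kij) _; move: hij; rewrite /h kij => /addnI.
  by have := pos_lt i; have := pos_lt j; lia.
Qed.

Let posE (c : {set 'I_n}) (a : 'I_#|c|) : c \in blocks -> pos (enum_val a) = a.
Proof.
move=> cb; rewrite /pos -(blocksP cb (enum_valP a)).
by rewrite (enum_val_nth (enum_val a)) index_uniq -?cardE ?enum_uniq.
Qed.

Let B'_trig i j : B' i j != 0 -> i = j \/ (h i < h j)%N.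
Proof.
move=> Bij; have ij := B'_incidence Bij.
have [ji|ji] := boolP (dom e j i); last first.
  right; apply: key_lt.
  exact: (radix_lt _ (ltn_ord (enum_rank (cls i))) (height_lt ij ji)).
have cij : cls i = cls j by apply: block_cls; rewrite /block ij ji.
have kij : key i = key j by rewrite /key cij (@height_eq i j) // /block ij.
rewrite /h kij ltn_add2l.
have [a ai] := in_cls i.
have [b bj] : exists b : 'I_#|cls i|, enum_val b = j.
  by exists (enum_rank_in (mem_cls i) j); rewrite enum_rankK_in ?cij ?mem_cls.
move: Bij; rewrite -{1}ai -{1}bj B'_block // => Bab.
have ab : (b <= a)%N.
  rewrite leqNgt; apply: contraNN Bab => ba.
  by have /is_trig_mxP T := P_trig (cls i); rewrite T.
have [ab'|ba'|/val_inj eab] := ltngtP a b; first by rewrite leqNgt ab' in ab.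
  have an : (a < n)%N.
    by apply: leq_trans (ltn_ord a) _; rewrite -[X in (_ <= X)%N]card_ord max_card.
  right; rewrite -ai -bj !posE //. by apply: ltn_sub2l => //; apply: ltn_trans an.
by left; rewrite -ai -bj eab.
Qed.

Let B'_galois (s : {rmorphism algC -> algC}) i :
  exists2 i', block e i i' & B' i' i' = s (B' i i).
Proof.
have [a ai] := in_cls i; rewrite -{2 3}ai B'_block //.
set D := sel (cls i) *m BK *m (sel (cls i))^T.
have H := eigenvalue_trig_diag (P_unit (cls i)) (P_trig (cls i)).
pose D0 : 'M[rat]_#|cls i| := \matrix_(x, y) B (enum_val x) (enum_val y).
have DE : D = map_mx ratr D0 by apply/matrixP=> x y; rewrite sel_sub !mxE.
have : eigenvalue D (s ((P (cls i) *m D *m invmx (P (cls i))) a a)).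
  have : eigenvalue D ((P (cls i) *m D *m invmx (P (cls i))) a a) by apply/H; exists a.
  rewrite !eigenvalue_root_char DE -map_char_poly -(fmorph_root s) -map_poly_comp.
  by rewrite (eq_map_poly (fmorph_rat _)).
case/H=> b Eb; exists (enum_val b).
  by have := enum_valP b; rewrite inE.
by rewrite B'_block.
Qed.

Lemma blockwise_triangularization :
  exists (g g' : 'M[algC]_n) (h : 'I_n -> nat),
  [/\ incidence e g /\ incidence e g', g *m g' = 1%:M /\ g' *m g = 1%:M,
      injective h,
      forall i j, (g *m BK *m g') i j != 0 -> i = j \/ (h i < h j)%N &
      forall (s : {rmorphism algC -> algC}) i,
        exists2 i', block e i i' & (g *m BK *m g') i' i' = s ((g *m BK *m g') i i)].
Proof.
exists g, g', h; split; last exact: B'_galois.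
- by split; apply: glue_incidence.
- by split; apply: glueV => c; rewrite ?mulmxV ?mulVmx ?P_unit.
- exact: h_inj.
- exact: B'_trig.
Qed.

End Triangularization.

(** * Trilinear forms on the degree-three part *)

Lemma max_mem (s : seq nat) : s != [::] -> exists2 m, m \in s & forall x, x \in s -> (x <= m)%N.
Proof.
elim: s => // a s IH _; have [->|/IH[m ms Hm]] := eqVneq s [::].
  by exists a; rewrite ?mem_head // => x; rewrite inE => /eqP->.
have [am|ma] := leqP a m.
  by exists m; rewrite ?inE ?ms ?orbT // => x; rewrite inE => /orP[/eqP->|/Hm].
exists a; rewrite ?mem_head // => x; rewrite inE => /orP[/eqP->//|/Hm xm].
exact: leq_trans xm (ltnW ma).
Qed.

Lemma sum_pow4_perm (s t : seq nat) : (size s <= 3)%N -> size s = size t ->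
  (\sum_(x <- s) 4 ^ x = \sum_(x <- t) 4 ^ x)%N -> perm_eq s t.
Proof.
have small (r : seq nat) m : (size r <= 3)%N -> (forall x, x \in r -> (x <= m)%N) ->
    (\sum_(x <- r) 4 ^ x < 4 ^ m.+1)%N.
  move=> r3 Hr; have : (\sum_(x <- r) 4 ^ x <= size r * 4 ^ m)%N.
    elim: r {r3} Hr => [|a r IH] Hr; first by rewrite big_nil.
    rewrite big_cons mulSn leq_add ?leq_pexp2l ?Hr ?mem_head // IH // => x xr.
    by rewrite Hr // inE xr orbT.
  rewrite expnS => /leq_ltn_trans; apply.
  by rewrite ltn_pmul2r ?expn_gt0.
have large (r : seq nat) m : m \in r -> (4 ^ m <= \sum_(x <- r) 4 ^ x)%N.
  by move=> mr; rewrite (perm_big _ (perm_to_rem mr)) big_cons leq_addr.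
have lem (r r' : seq nat) m m' : (size r <= 3)%N -> (forall x, x \in r -> (x <= m)%N) ->
    m' \in r' -> (\sum_(x <- r) 4 ^ x = \sum_(x <- r') 4 ^ x)%N -> (m' <= m)%N.
  move=> r3 Hr m'r' E; have := leq_ltn_trans (large _ _ m'r') _.
  by rewrite -E => /(_ _ (small _ _ r3 Hr)); rewrite ltn_exp2l.
move: {2}(size s) (erefl (size s)) => d; elim: d s t => [|d IH] s t sd.
  by move=> _; rewrite sd; case: s sd => //; case: t.
move=> s3 st E.
have s0 : s != [::] by apply: contraPneq sd => ->.
have t0 : t != [::] by apply: contraPneq sd => t0; rewrite st t0.
have [m ms Hm] := max_mem s0; have [m' m't Hm'] := max_mem t0.
have mm' : m = m'.
  apply/eqP; rewrite eqn_leq (lem _ _ _ _ _ Hm' ms) -?st //.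
  by rewrite (lem _ _ _ _ _ Hm m't).
rewrite -mm' in m't; have ps := perm_to_rem ms; have pt := perm_to_rem m't.
rewrite (perm_trans ps) // perm_sym (perm_trans pt) // perm_cons perm_sym.
move: E; rewrite (perm_big _ ps) (perm_big _ pt) !big_cons => /addnI E.
by apply: IH => //; rewrite ?size_rem // -?st ?sd // -ltnS -sd; lia.
Qed.

Lemma rational_unit_norm (z : algC) : z \in Crat -> z != 0 -> z \in Aint ->
  z^-1 \in Aint -> `|z| = 1.
Proof.
move=> zQ z0 zA zVA.
have zZ : z \in Num.int by apply: Cint_rat_Aint.
have zVZ : z^-1 \in Num.int by apply: Cint_rat_Aint; rewrite ?rpredV.
apply/eqP; rewrite eq_le norm_intr_ge1 // andbT.
by rewrite -[`|z|]invrK -normfV invf_le1 ?norm_intr_ge1 ?normr_gt0 ?invr_eq0.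
Qed.

Section Forms.
Variables (n : nat) (e : rel 'I_n).
Hypotheses (e_sym : symmetric e) (e_irr : irreflexive e).
Local Notation T3 := ('I_n * 'I_n * 'I_n)%type.
Local Notation form := {ffun T3 -> algC^o}.
Implicit Types (F : form) (G : 'M[algC]_n) (i j k : 'I_n) (p q : T3).

(* The functionals on the degree-three part, as functions of (x, y, z)
   standing for the value at [x, [y, z]]. *)
Definition is_form F :=
  [/\ forall x y z, F (x, y, z) = - F (x, z, y),
      forall x y z, F (x, y, z) + F (y, z, x) + F (z, x, y) = 0 &
      forall x y z, ~~ e y z -> F (x, y, z) = 0].

Definition pullback G F : form :=
  [ffun p => \sum_q F q * (G q.1.1 p.1.1 * G q.1.2 p.1.2 * G q.2 p.2)].

Lemma is_formP a F1 F2 : is_form F1 -> is_form F2 -> is_form (a *: F1 + F2).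
Proof.
move=> [A1 J1 N1] [A2 J2 N2]; split=> x y z; rewrite !ffunE /=.
- by rewrite A1 A2 scalerN opprD.
- have {}J1 := J1 x y z; have {}J2 := J2 x y z.
  transitivity (a * (F1 (x, y, z) + F1 (y, z, x) + F1 (z, x, y))
     + (F2 (x, y, z) + F2 (y, z, x) + F2 (z, x, y))); first by rewrite /GRing.scale /=; ring.
  by rewrite J1 J2 mulr0 addr0.
- by move=> yz; rewrite N1 // N2 // scaler0 addr0.
Qed.

Lemma pullbackP G a F1 F2 :
  pullback G (a *: F1 + F2) = a *: pullback G F1 + pullback G F2.
Proof.
apply/ffunP=> p; rewrite !ffunE scaler_sumr -big_split; apply: eq_bigr => q _.
by rewrite !ffunE mulrDl -scalerAl.
Qed.
HB.instance Definition _ G := GRing.isLinear.Build algC form form *:%R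
  (pullback G) (pullbackP G).

Lemma sum_triple (R : comNzRingType) (f g h : 'I_n -> R) :
  \sum_(q : T3) f q.1.1 * g q.1.2 * h q.2 = (\sum_i f i) * (\sum_i g i) * (\sum_i h i).
Proof.
rewrite big_distrlr /= pair_bigA big_distrlr /= pair_bigA.
by apply: eq_bigr => -[[]].
Qed.

Lemma pullbackM G1 G2 F : pullback (G1 *m G2) F = pullback G2 (pullback G1 F).
Proof.
apply/ffunP=> p; rewrite !ffunE.
under [RHS]eq_bigr do rewrite ffunE big_distrl.
rewrite exchange_big; apply: eq_bigr => q _ /=.
under eq_bigr do rewrite -mulrA.
rewrite -big_distrr /= !mxE -sum_triple; congr (_ * _); apply: eq_bigr => r _ /=.
by ring.
Qed.

Lemma sum_pullback G F (u v t : 'I_n -> algC) :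
  \sum_p F p * ((\sum_l G p.1.1 l * u l) * (\sum_l G p.1.2 l * v l) * (\sum_l G p.2 l * t l))
  = \sum_p pullback G F p * (u p.1.1 * v p.1.2 * t p.2).
Proof.
under [RHS]eq_bigr do rewrite ffunE big_distrl.
rewrite exchange_big; apply: eq_bigr => q _ /=.
rewrite -sum_triple big_distrr; apply: eq_bigr => r _ /=.
by ring.
Qed.

Lemma pullback1 F : pullback 1%:M F = F.
Proof.
apply/ffunP=> p; rewrite !ffunE (bigD1 p) //= big1 ?addr0 => [|q qp].
  by rewrite !mxE !eqxx !mulr1.
rewrite !mxE; case: eqP => [E1|_]; last by rewrite !mul0r mulr0.
case: eqP => [E2|_]; last by rewrite mulr0 mul0r mulr0.
case: eqP => [E3|_]; last by rewrite !mulr0.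
by case/eqP: qp; case: p q E1 E2 E3 => [[? ?] ?] [[? ?] ?] /= -> -> ->.
Qed.

Lemma pullback_form G F : incidence e G -> is_form F -> is_form (pullback G F).
Proof.
move=> PG [A J N].
have sw : injective (fun q : T3 => (q.1.1, q.2, q.1.2)).
  by move=> [[? ?] ?] [[? ?] ?] [-> -> ->].
have ro : injective (fun q : T3 => (q.1.2, q.2, q.1.1)).
  by move=> [[? ?] ?] [[? ?] ?] [-> -> ->].
have ro2 : injective (fun q : T3 => (q.2, q.1.1, q.1.2)).
  by move=> [[? ?] ?] [[? ?] ?] [-> -> ->].
have A' x y z : pullback G F (x, y, z) = - pullback G F (x, z, y).
  rewrite !ffunE (reindex_inj sw) -sumrN; apply: eq_bigr => -[[a b] c] _ /=.
  by rewrite (A a c b); ring.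
split=> // x y z.
- rewrite !ffunE [X in _ + X + _](reindex_inj ro) [X in _ + _ + X](reindex_inj ro2).
  rewrite -!big_split big1 //= => -[[a b] c] _ /=.
  transitivity ((F (a, b, c) + F (b, c, a) + F (c, a, b)) * (G a x * G b y * G c z)).
    by ring.
  by rewrite J mul0r.
have [->|yz] := eqVneq y z.
  move=> _; have /eqP := A' x z z; rewrite -addr_eq0 -mulr2n mulrn_eq0.
  by move=> /eqP.
move=> nyz; rewrite ffunE big1 // => -[[a b] c] _ /=.
have [bc|bc] := boolP (e b c); last by rewrite N // mul0r.
have [->|/PG dy] := eqVneq (G b y) 0; first by rewrite mulr0 mul0r mulr0.
have [->|/PG dz] := eqVneq (G c z) 0; first by rewrite !mulr0.
have [E|E] := dom_edge e_sym dy dz bc; first by rewrite E eqxx in yz.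
by rewrite E in nyz.
Qed.

Definition path_form i j k : form :=
  [ffun p => (p.1.1 == i)%:R * ((p.1.2 == j)%:R * (p.2 == k)%:R - (p.1.2 == k)%:R * (p.2 == j)%:R)
    - (p.1.1 == k)%:R * ((p.1.2 == i)%:R * (p.2 == j)%:R - (p.1.2 == j)%:R * (p.2 == i)%:R)].

Lemma path_formP i j k : e i j -> e j k -> is_form (path_form i j k).
Proof.
move=> ij jk.
have edge0 a b y z : e a b -> ~~ e y z -> (y == a)%:R * (z == b)%:R = 0 :> algC.
  move=> ab; case: eqP => [->|_]; last by rewrite mul0r.
  by case: eqP => [->|_]; [rewrite ab|rewrite mulr0].
split=> x y z; rewrite !ffunE /=; [by ring|by ring|move=> yz].
rewrite (edge0 _ _ _ _ jk yz) (edge0 k j) // 1?e_sym // (edge0 i j) //.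
by rewrite (edge0 j i) // 1?e_sym // !subr0 !mulr0 subr0.
Qed.

Lemma path_form_neq0 i j k : e i j -> e j k -> path_form i j k (i, j, k) != 0.
Proof.
move=> ij jk; rewrite ffunE /= !eqxx.
have /negPf ij' : i != j by apply: contraTneq ij => ->; rewrite e_irr.
have /negPf jk' : j != k by apply: contraTneq jk => ->; rewrite e_irr.
rewrite [j == i]eq_sym ij' jk' [k == j]eq_sym jk' !(mulr0, mul0r, mul1r, subr0, sub0r).
have [_|_] := eqVneq i k; last by rewrite mul0r subr0 oner_eq0.
by rewrite /= mul1r opprK -[1 + 1]/(2%:R) pnatr_eq0.
Qed.

Lemma path_form_support i j k p : path_form i j k p != 0 ->
  p \in [:: (i, j, k); (i, k, j); (k, i, j); (k, j, i)].
Proof.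
case: p => [[x y] z]; rewrite !inE !xpair_eqE ffunE /= => nz.
apply: contraTT nz; rewrite negbK.
case: (x == i); case: (x == k); case: (y == j); case: (z == k); case: (y == k);
  case: (z == j); case: (y == i); case: (z == i) => //= _;
  by rewrite ?(mul0r, mulr0, mul1r, subr0, subrr, oppr0).
Qed.

End Forms.

Section Core.
Variables (n : nat) (e : rel 'I_n).
Hypotheses (e_sym : symmetric e) (e_irr : irreflexive e).
Local Notation T3 := ('I_n * 'I_n * 'I_n)%type.
Local Notation form := {ffun T3 -> algC^o}.
Local Notation is_form := (is_form e).
Implicit Types (F : form) (i j k : 'I_n) (p q : T3).

Variables (B : 'M[algC]_n) (h : 'I_n -> nat) (eps : form -> algC) (mu : algC).
Hypotheses (B_inc : incidence e B) (h_inj : injective h).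
Hypothesis B_trig : forall i j, B i j != 0 -> i = j \/ (h i < h j)%N.
Hypothesis epsD : forall a F1 F2, eps (a *: F1 + F2) = a * eps F1 + eps F2.
Hypothesis eps_pullback : forall F, is_form F -> eps (pullback B F) = mu * eps F.
Hypothesis eps_neq0 : exists2 F, is_form F & eps F != 0.
Hypothesis ker_eps_spectrum : forall F z,
  is_form F -> F != 0 -> eps F = 0 -> pullback B F = z *: F -> `|z| != 1.

Let w i := B i i.
Let wt p := w p.1.1 * w p.1.2 * w p.2.
(* With powers of 4 the level determines the multiset of the three vertices. *)
Let lev p := (4 ^ h p.1.1 + 4 ^ h p.1.2 + 4 ^ h p.2)%N.
Let above m F := forall p, (lev p < m)%N -> F p = 0.

Let eps0 : eps 0 = 0.
Proof. by have := epsD (-1) 0 0; rewrite scaler0 addr0 mulN1r addNr. Qed.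

Let lev_perm p q : lev p = lev q ->
  perm_eq [:: p.1.1; p.1.2; p.2] [:: q.1.1; q.1.2; q.2].
Proof.
move=> pq; apply: (perm_map_inj h_inj); apply: sum_pow4_perm => //=.
by rewrite !big_cons !big_nil !addn0 !addnA.
Qed.

Let lev_wt p q : lev p = lev q -> wt p = wt q.
Proof.
move/lev_perm=> pq; have : \prod_(i <- [:: p.1.1; p.1.2; p.2]) w i
    = \prod_(i <- [:: q.1.1; q.1.2; q.2]) w i by apply: perm_big.
by rewrite !big_cons !big_nil !mulr1 !mulrA.
Qed.

Let aboveP m a F1 F2 : above m F1 -> above m F2 -> above m (a *: F1 + F2).
Proof. by move=> F1m F2m p pm; rewrite !ffunE F1m // F2m // scaler0 addr0. Qed.

Let pullback_low m F p : above m F -> (lev p <= m)%N -> pullback B F p = wt p * F p.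
Proof.
move=> Fm pm; rewrite ffunE (bigD1 p) //= big1 => [|q qp]; first by rewrite addr0 mulrC.
have [->|/B_trig q1] := eqVneq (B q.1.1 p.1.1) 0; first by rewrite !mul0r mulr0.
have [->|/B_trig q2] := eqVneq (B q.1.2 p.1.2) 0; first by rewrite mulr0 mul0r mulr0.
have [->|/B_trig q3] := eqVneq (B q.2 p.2) 0; first by rewrite !mulr0.
rewrite Fm ?mul0r // (leq_trans _ pm) // /lev.
have le i j : i = j \/ (h i < h j)%N -> (4 ^ h i <= 4 ^ h j)%N.
  by case=> [->//|/ltnW]; rewrite leq_exp2l.
have lt i j : i = j \/ (h i < h j)%N -> i != j -> (4 ^ h i < 4 ^ h j)%N.
  by case=> [->|ij _]; [rewrite eqxx|rewrite ltn_exp2l].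
have := le _ _ q1; have := le _ _ q2; have := le _ _ q3.
have [E1|/(lt _ _ q1)] := eqVneq q.1.1 p.1.1; last by lia.
have [E2|/(lt _ _ q2)] := eqVneq q.1.2 p.1.2; last by lia.
have [E3|/(lt _ _ q3)] := eqVneq q.2 p.2; last by lia.
by case/eqP: qp; case: p q E1 E2 E3 {pm q1 q2 q3} => [[? ?] ?] [[? ?] ?] /= -> -> ->.
Qed.

Let above_pullback m F : above m F -> above m (pullback B F).
Proof. by move=> Fm p pm; rewrite (pullback_low Fm (ltnW pm)) (Fm _ pm) mulr0. Qed.

Let not_in_kernel m F p : is_form F -> above m F -> lev p = m -> F p != 0 ->
  `|wt p| = 1 -> eps F != 0.
Proof.
move=> Ff Fm pm Fp wp; apply/eqP=> F0.
have [||||||G [[Gf Gm G0] Gn0 BG]] := @eigenvector_of_functional _ _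
   (linfun (pullback B)) (fun F => [/\ is_form F, above m F & eps F = 0])
   (fun F => F p) (wt p) F.
- move=> a x y [xf xm x0] [yf ym y0]; split; [exact: is_formP|exact: aboveP|].
  by rewrite epsD x0 y0 mulr0 addr0.
- move=> x [xf xm x0]; rewrite lfunE /=; split.
  + exact: pullback_form.
  + exact: above_pullback.
  + by rewrite eps_pullback // x0 mulr0.
- by move=> a x y; rewrite !ffunE.
- by move=> x [xf xm x0]; rewrite lfunE /= (pullback_low xm) ?pm.
- by [].
- by [].
rewrite lfunE /= in BG; have := ker_eps_spectrum Gf Gn0 G0 BG.
by rewrite wp eqxx.
Qed.

Let above_in_kernel m F p : is_form F -> above m F -> lev p = m -> F p != 0 ->
  `|wt p| = 1 -> forall F', is_form F' -> above m.+1 F' -> eps F' = 0.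
Proof.
move=> Ff Fm pm Fp wp F' F'f F'm; apply/eqP; apply: contraTT isT => F'0.
pose G := - (eps F / eps F') *: F' + F.
have Gf : is_form G by apply: is_formP.
have Gm : above m G by apply: aboveP => // q qm; apply: F'm; apply: ltnW.
have Gp : G p != 0 by rewrite !ffunE F'm ?pm // scaler0 add0r.
have := not_in_kernel Gf Gm pm Gp wp.
by rewrite epsD mulNr mulfVK // addNr eqxx.
Qed.

Let above_path i j k : e i j -> e j k -> above (lev (i, j, k)) (path_form i j k).
Proof.
move=> ij jk p; apply: contraTeq => /path_form_support.
by rewrite !inE /lev => /or4P[] /eqP-> /=; lia.
Qed.

Let unimodular_path_lev i j k i' j' k' :
  e i j -> e j k -> e i' j' -> e j' k' ->
  `|w i * w j * w k| = 1 -> `|w i' * w j' * w k'| = 1 ->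
  lev (i, j, k) = lev (i', j', k').
Proof.
have lt a b c a' b' c' : e a b -> e b c -> e a' b' -> e b' c' ->
    `|w a * w b * w c| = 1 -> `|w a' * w b' * w c'| = 1 ->
    (lev (a, b, c) < lev (a', b', c'))%N -> False.
  move=> ab bc ab' bc' w1 w2 lt.
  have /eqP[] := not_in_kernel (path_formP e_sym ab' bc') (above_path ab' bc') erefl
    (path_form_neq0 e_irr ab' bc') w2.
  apply: (above_in_kernel (path_formP e_sym ab bc) (above_path ab bc) erefl
    (path_form_neq0 e_irr ab bc) w1); first exact: path_formP.
  by move=> p pm; apply: above_path => //; apply: leq_trans pm lt.
move=> ij jk ij' jk' w1 w2.
have [L|L|//] := ltngtP (lev (i, j, k)) (lev (i', j', k')).
  by case: (lt _ _ _ _ _ _ ij jk ij' jk' w1 w2 L).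
by case: (lt _ _ _ _ _ _ ij' jk' ij jk w2 w1 L).
Qed.

Let weighted_path : exists i j k, [/\ e i j, e j k & w i * w j * w k = mu].
Proof.
pose bound := (\max_(p : T3) lev p).+1.
have lev_bound p : (lev p < bound)%N by rewrite ltnS leq_bigmax.
suff H d F : is_form F -> above (bound - d) F -> eps F != 0 ->
    exists i j k, [/\ e i j, e j k & w i * w j * w k = mu].
  have [F Ff F0] := eps_neq0; apply: (H bound F) => //.
  by move=> p; rewrite subnn.
elim: d F => [|d IH] F Ff Fm F0.
  case/eqP: F0; rewrite (_ : F = 0) //; apply/ffunP=> p.
  by rewrite ffunE Fm // subn0.
have [db|bd] := leqP bound d.
  by apply: (IH F) => // p pm; apply: Fm; move: pm; lia.
have Em : (bound - d = (bound - d.+1).+1)%N by lia.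
set m := (bound - d.+1)%N in Fm Em.
have [/existsP[p /andP[/eqP pm Fp]]|] := boolP [exists p, (lev p == m) && (F p != 0)]; last first.
  move=> /existsPn H; apply: (IH F) => // p; rewrite Em ltnS leq_eqVlt.
  case/orP=> [pm|]; last exact: Fm.
  by have := H p; rewrite pm negbK => /eqP.
have [wm|wm] := eqVneq (wt p) mu; last first.
  apply: (IH (- wt p *: F + pullback B F)).
  - by apply: is_formP => //; apply: pullback_form.
  - move=> q; rewrite Em ltnS => qm.
    rewrite [LHS]ffunE [X in X + _]ffunE (pullback_low Fm qm).
    move: qm; rewrite leq_eqVlt => /orP[/eqP qm|qm].
      by rewrite (@lev_wt p q) ?qm // scaleNr addNr.
    by rewrite (Fm _ qm) scaler0 mulr0 addr0.
  - by rewrite epsD eps_pullback // -mulrDl mulf_neq0 // addrC subr_eq0 eq_sym.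
have [A J N] := Ff; case: p pm Fp wm => [[x y] z] /= _ Fp wm.
have yz : e y z by apply: contraNT Fp => /N->.
have [xy|xy] := boolP (e x y); first by exists x, y, z.
have [xz|xz] := boolP (e x z).
  by exists x, z, y; split=> //; [rewrite e_sym|rewrite -wm /wt /= mulrAC].
case/eqP: Fp; have := J x y z; rewrite (N z x y) // (N y z x) 1?e_sym //.
by rewrite !addr0.
Qed.

Hypothesis B_diag : forall i,
  [/\ B i i != 0, B i i \in Aint, (B i i)^-1 \in Aint & `|B i i| != 1].
Hypothesis B_galois : forall (s : {rmorphism algC -> algC}) i,
  exists2 i', block e i i' & B i' i' = s (B i i).
Hypothesis mu_rat : mu \in Crat.

Let w_irrational i : w i \notin Crat.
Proof.
have [w0 wA wV w1] := B_diag i; apply: contraNN w1 => wQ.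
by apply/eqP/rational_unit_norm.
Qed.

Let mu_norm : `|mu| = 1.
Proof.
have [i [j [k [_ _ wmu]]]] := weighted_path; apply: rational_unit_norm => //.
- have w0 x : w x != 0 by have [] := B_diag x.
  by rewrite -wmu !mulf_neq0.
- rewrite -wmu; have [_ a _ _] := B_diag i; have [_ b _ _] := B_diag j.
  by have [_ c _ _] := B_diag k; exact: rpredM (rpredM a b) c.
- rewrite -wmu !invfM; have [_ _ a _] := B_diag i; have [_ _ b _] := B_diag j.
  by have [_ _ c _] := B_diag k; exact: rpredM (rpredM a b) c.
Qed.

Let no_triangle i j k : e i j -> e j k -> w i * w j * w k = mu -> ~~ e i k.
Proof.
move=> ij jk wmu; apply/negP=> ik; have ki : e k i by rewrite e_sym.
have m1 : `|w i * w j * w k| = 1 by rewrite wmu.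
have F1 := not_in_kernel (path_formP e_sym ij jk) (above_path ij jk) erefl
  (path_form_neq0 e_irr ij jk) m1.
pose F := - (eps (path_form j k i) / eps (path_form i j k)) *: path_form i j k
  + path_form j k i.
have Elev : lev (j, k, i) = lev (i, j, k) by rewrite /lev /=; lia.
have Ff : is_form F by apply: is_formP; apply: path_formP.
have Fm : above (lev (i, j, k)) F.
  by apply: aboveP; [exact: above_path|rewrite -Elev; exact: above_path].
have Fp : F (j, k, i) != 0.
  have ne a b : e a b -> (a == b) = false.
    by apply: contraTF => /eqP->; rewrite e_irr.
  have -> : F (j, k, i) = path_form j k i (j, k, i).
    rewrite [LHS]ffunE [X in X + _]ffunE [path_form i j k _]ffunE /=.
    by rewrite [j == i]eq_sym (ne _ _ ij) (ne _ _ jk) !mul0r subr0 scaler0 add0r.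
  exact: (path_form_neq0 e_irr jk ki).
have wp : `|wt (j, k, i)| = 1 by rewrite (lev_wt Elev) /wt.
have := not_in_kernel Ff Fm Elev Fp wp.
by rewrite epsD mulNr mulfVK // addNr eqxx.
Qed.

Let path_mem i j k i' j' k' : e i j -> e j k -> e i' j' -> e j' k' ->
  w i * w j * w k = mu -> w i' * w j' * w k' = mu ->
  perm_eq [:: i; j; k] [:: i'; j'; k'].
Proof.
move=> ij jk ij' jk' w1 w2.
by apply: (@lev_perm (i, j, k) (i', j', k')); apply: unimodular_path_lev; rewrite ?w1 ?w2.
Qed.

Let conj_weight (s : {rmorphism algC -> algC}) i j k i' j' k' :
  w i' = s (w i) -> w j' = s (w j) -> w k' = s (w k) ->
  w i * w j * w k = mu -> w i' * w j' * w k' = mu.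
Proof. by move=> -> -> -> wmu; rewrite -!rmorphM /= wmu aut_Crat. Qed.

Let no_double i j : e i j -> w i * w j * w i = mu -> False.
Proof.
move=> ij wmu; have [s sw] := aut_moving (w_irrational i).
have [i' ii' wi'] := B_galois s i; have [j' jj' wj'] := B_galois s j.
have wmu' := conj_weight wi' wj' wi' wmu.
have ij'_neq : i' != j'.
  apply: contraTneq isT => eij; have wij : w i = w j.
    by apply: (fmorph_inj s); rewrite -wi' -wj' eij.
  have [_ _ _ /eqP[]] := B_diag i; apply/eqP.
  rewrite -(@pexpr_eq1 _ _ 3) // -normrX.
  by rewrite !exprS expr0 mulr1 mulrA -/(w i) {2}wij wmu mu_norm.
have ij' : e i' j' by apply: block_edge ij.
have ji : e j i by rewrite e_sym.
have ji' : e j' i' by rewrite e_sym.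
have := path_mem ij ji ij' ji' wmu wmu' => /permP /(_ (pred1 i')) /=.
rewrite eqxx [j' == i']eq_sym (negPf ij'_neq).
have -> : (i == i') = false by apply: contraNF sw => /eqP {2}->; rewrite -wi'.
by case: (j == i').
Qed.

Lemma no_invariant_line : False.
Proof.
have [i [j [k [ij jk wmu]]]] := weighted_path.
have nik := no_triangle ij jk wmu.
have [eik|ne_ik] := eqVneq i k.
  by rewrite -eik in wmu; exact: no_double ij wmu.
have [s sw] := aut_moving (w_irrational j).
have [i' ii' wi'] := B_galois s i; have [j' jj' wj'] := B_galois s j.
have [k' kk' wk'] := B_galois s k.
have wmu' := conj_weight wi' wj' wk' wmu.
have nbij : ~~ block e j i.
  apply: contraNN nik => /andP[/domP ji _]; have [ki|//] := ji _ jk.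
  by rewrite ki eqxx in ne_ik.
have nbjk : ~~ block e j k.
  apply: contraNN nik => /andP[/domP jk' _].
  have [|ik|] := jk' i; [by rewrite e_sym| |by rewrite e_sym].
  by rewrite ik eqxx in ne_ik.
have ij' : e i' j'.
  apply: block_edge ij => //; apply: contraNneq nbij => eij.
  by apply: block_trans jj' _; rewrite // -eij block_sym.
have jk' : e j' k'.
  apply: block_edge jk => //; apply: contraNneq nbjk => ejk.
  by apply: block_trans jj' _; rewrite // ejk block_sym.
have := path_mem ij jk ij' jk' wmu wmu' => /perm_mem /(_ j').
rewrite !inE eqxx orbT => /or3P[] /eqP E.
- by rewrite E in jj'; rewrite jj' in nbij.
- by move: sw; rewrite -[s (w j)]wj' E eqxx.
- by rewrite E in jj'; rewrite jj' in nbjk.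
Qed.

End Core.

Lemma no_hyperbolic_incidence (n : nat) (e : rel 'I_n) (A A' : 'M[rat]_n)
    (eps : {ffun 'I_n * 'I_n * 'I_n -> algC^o} -> algC) :
  symmetric e -> irreflexive e ->
  bracket_compat e A -> bracket_compat e A' -> A *m A' = 1%:M ->
  (forall a F1 F2, eps (a *: F1 + F2) = a * eps F1 + eps F2) ->
  (exists2 F, is_form e F & eps F != 0) ->
  let pw k := map_mx (ratr : rat -> algC) (iter k (mulmx A) 1%:M) in
  (forall k, incidence e (pw k) -> exists mu : rat, forall F, is_form e F ->
     eps (pullback (pw k) F) = ratr mu * eps F) ->
  (forall k F z, (0 < k)%N -> is_form e F -> F != 0 -> eps F = 0 ->
     pullback (pw k) F = z *: F -> `|z| != 1) ->
  (forall k (v : 'rV[algC]_n) z, (0 < k)%N -> v != 0 -> v *m pw k = z *: v ->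
     [/\ z != 0, z \in Aint, z^-1 \in Aint & `|z| != 1]) ->
  False.
Proof.
move=> e_sym e_irr cA cA' AA' epsD [F0 F0f F0n] pw Hmu Hspec3 Hspec1.
have [k k0 Bk] := power_in_incidence e_sym e_irr (bracket_compat_nonedge_stable cA)
  (bracket_compat_nonedge_stable cA') AA'.
have BKk : incidence e (pw k) by move=> i j; rewrite mxE fmorph_eq0; exact: Bk.
have [mu Emu] := Hmu k BKk.
have [g [g' [h [[gi g'i] [gg' g'g] h_inj B_trig B_gal]]]] := blockwise_triangularization e_sym Bk.
rewrite -/(pw k) in B_trig B_gal; set B := g *m pw k *m g' in B_trig B_gal.
have Bg : B *m g = g *m pw k by rewrite /B -mulmxA g'g mulmx1.
have Bi : incidence e B by do 2?apply: incidenceM => //.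
have pgB F : pullback g (pullback B F) = pullback (pw k) (pullback g F).
  by rewrite -!pullbackM Bg.
apply: (@no_invariant_line n e e_sym e_irr B h (fun F => eps (pullback g F)) (ratr mu)) => //.
- by move=> a F1 F2; rewrite linearP epsD.
- by move=> F Ff; rewrite pgB Emu //; apply: pullback_form.
- exists (pullback g' F0); first exact: pullback_form.
  by rewrite -pullbackM g'g pullback1.
- move=> F z Ff Fn F_0 BF; apply: (Hspec3 k (pullback g F) z) => //.
  + exact: pullback_form.
  + apply: contraNneq Fn => gF; rewrite -[F]pullback1 -gg' pullbackM gF.
    by rewrite linear0.
  + by rewrite -pgB BF linearZ.
- move=> i; have [||||||v [_ v0 vB]] := @eigenvector_of_functional _ _
      (linfun (mulmxr B : 'rV[algC]_n -> 'rV[algC]_n))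
      (fun v => forall j, v 0 j != 0 -> (h i <= h j)%N)
      (fun v => v 0 i) (B i i) (delta_mx 0 i).
  + move=> a x y Px Py j; rewrite !mxE.
    have [->|/Px//] := eqVneq (x 0 j) 0; have [->|/Py//] := eqVneq (y 0 j) 0.
    by rewrite mulr0 addr0 eqxx.
  + move=> x Px j; rewrite lfunE /= mxE; apply: contraNT; rewrite -ltnNge => ji.
    apply/eqP; apply: big1 => a _; have [->|/Px ia] := eqVneq (x 0 a) 0; first exact: mul0r.
    have [->|/B_trig[E|aj]] := eqVneq (B a j) 0; first exact: mulr0.
      by move: ji; rewrite -E ltnNge ia.
    by have := leq_ltn_trans ia (ltn_trans aj ji); rewrite ltnn.
  + by move=> a x y; rewrite !mxE.
  + move=> x Px; rewrite lfunE /= mxE (bigD1 i) //= big1 => [|a ai].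
      by rewrite addr0 mulrC.
    have [->|/Px ia] := eqVneq (x 0 a) 0; first exact: mul0r.
    have [->|/B_trig[E|aj]] := eqVneq (B a i) 0; first exact: mulr0.
      by rewrite E eqxx in ai.
    by have := leq_ltn_trans ia aj; rewrite ltnn.
  + by move=> j; rewrite mxE eqxx; case: (eqVneq j i) => [->|]; rewrite ?eqxx.
  + by rewrite mxE !eqxx oner_eq0.
  rewrite lfunE /= in vB; apply: (Hspec1 k (v *m g)) => //.
    apply: contraNneq v0 => vg; rewrite -[v]mulmx1 -gg' mulmxA vg mul0mx //.
  by rewrite -mulmxA -Bg mulmxA vB scalemxAl.
- exact: Crat_rat.
Qed.

(** * Coordinates on the Lie algebra *)

Section Coordinates.
Variables (S : finType) (E : rel S).
Hypotheses (E_sym : symmetric E) (E_irr : irreflexive E).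

Local Notation n := #|S|.
Local Notation L := (free_nil3 S).
Local Notation Q := (graph_lie E).
Local Notation T3 := ('I_n * 'I_n * 'I_n)%type.
Local Notation form := {ffun T3 -> algC^o}.
Local Notation gen i := (free_gen (enum_val i)).

Definition edge (i j : 'I_n) := E (enum_val i) (enum_val j).

Definition tens1 (x : L) (i : 'I_n) : rat := (vsval x).1.1 (enum_val i).
Definition tens2 (x : L) (i j : 'I_n) : rat := (vsval x).1.2 (enum_val i, enum_val j).
Definition tens3 (x : L) (p : T3) : rat :=
  (vsval x).2 (enum_val p.1.1, enum_val p.1.2, enum_val p.2).

Lemma tens1P a x y i : tens1 (a *: x + y) i = a * tens1 x i + tens1 y i.
Proof. by rewrite /tens1 linearP !ffunE. Qed.

Lemma tens2P a x y i j : tens2 (a *: x + y) i j = a * tens2 x i j + tens2 y i j.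
Proof. by rewrite /tens2 linearP !ffunE. Qed.

Lemma tens3P a x y p : tens3 (a *: x + y) p = a * tens3 x p + tens3 y p.
Proof. by rewrite /tens3 linearP !ffunE. Qed.

Lemma tens1_lie x y i : tens1 (lie x y) i = 0.
Proof. by rewrite /tens1 subLieE /lie /= !ffunE subr0. Qed.

Lemma tens2_lie x y i j :
  tens2 (lie x y) i j = tens1 x i * tens1 y j - tens1 y i * tens1 x j.
Proof. by rewrite /tens2 subLieE /lie /= !ffunE. Qed.

Lemma tens3_lie x y p : tens3 (lie x y) p =
  tens1 x p.1.1 * tens2 y p.1.2 p.2 + tens2 x p.1.1 p.1.2 * tens1 y p.2
  - (tens1 y p.1.1 * tens2 x p.1.2 p.2 + tens2 y p.1.1 p.1.2 * tens1 x p.2).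
Proof. by rewrite /tens3 subLieE /lie /= !ffunE. Qed.

Lemma tens1_gen i j : tens1 (gen j) i = (i == j)%:R.
Proof. by rewrite /tens1 val_free_gen /= ffunE (inj_eq enum_val_inj). Qed.

(* The factor 1/3 comes from the Jacobi identity for F: see tri_pair_lie. *)
Definition tri_pair (F : form) (x : L) : algC :=
  3^-1 * \sum_p F p * ratr (tens3 x p).

Lemma tri_pairP F a x y :
  tri_pair F (a *: x + y) = ratr a * tri_pair F x + tri_pair F y.
Proof.
rewrite /tri_pair mulrCA -mulrDr; congr (_ * _).
rewrite big_distrr -big_split; apply: eq_bigr => p _ /=.
by rewrite tens3P rmorphD rmorphM /=; ring.
Qed.

Lemma tri_pairPl F1 F2 a x :
  tri_pair (a *: F1 + F2) x = a * tri_pair F1 x + tri_pair F2 x.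
Proof.
rewrite /tri_pair mulrCA -mulrDr; congr (_ * _).
rewrite big_distrr -big_split; apply: eq_bigr => p _ /=.
by rewrite !ffunE /GRing.scale /=; ring.
Qed.

Lemma tri_pair_lie F x y z : is_form edge F ->
  tri_pair F (lie x (lie y z)) =
  \sum_p F p * (ratr (tens1 x p.1.1) * ratr (tens1 y p.1.2) * ratr (tens1 z p.2)).
Proof.
move=> [A J N]; rewrite /tri_pair.
pose t p : algC := ratr (tens1 x p.1.1) * ratr (tens1 y p.1.2) * ratr (tens1 z p.2).
have sw : injective (fun q : T3 => (q.1.1, q.2, q.1.2)).
  by move=> [[? ?] ?] [[? ?] ?] [-> -> ->].
have ro : injective (fun q : T3 => (q.1.2, q.2, q.1.1)).
  by move=> [[? ?] ?] [[? ?] ?] [-> -> ->].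
have rv : injective (fun q : T3 => (q.2, q.1.2, q.1.1)).
  by move=> [[? ?] ?] [[? ?] ?] [-> -> ->].
pose r1 p : algC := ratr (tens1 x p.1.1) * ratr (tens1 z p.1.2) * ratr (tens1 y p.2).
pose r2 p : algC := ratr (tens1 y p.1.1) * ratr (tens1 z p.1.2) * ratr (tens1 x p.2).
pose r3 p : algC := ratr (tens1 z p.1.1) * ratr (tens1 y p.1.2) * ratr (tens1 x p.2).
transitivity (3^-1 * (\sum_p F p * t p - \sum_p F p * r1 p - \sum_p F p * r2 p
    + \sum_p F p * r3 p)).
  congr (_ * _); rewrite -!sumrB -big_split; apply: eq_bigr => p _ /=.
  rewrite tens3_lie !tens2_lie !tens1_lie /t /r1 /r2 /r3.
  by rewrite !(rmorphD, rmorphN, rmorphM, rmorph0) /=; ring.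
rewrite [X in _ - X - _](reindex_inj sw) [X in _ - _ - X](reindex_inj ro) [X in _ + X](reindex_inj rv) /=.
rewrite -!sumrB -big_split big_distrr; apply: eq_bigr => -[[a b] c] _ /=.
rewrite /t /r1 /r2 /r3 /= (A a c b) (A c b a).
have -> : F (b, c, a) = - F (a, b, c) - F (c, a, b).
  by apply/eqP; rewrite -subr_eq0; apply/eqP; rewrite -(J a b c); ring.
by field.
Qed.

Definition functional (M : lmodType rat) (phi : M -> algC) :=
  forall a x y, phi (a *: x + y) = ratr a * phi x + phi y.

Lemma functional0 (M : lmodType rat) (phi : M -> algC) : functional phi -> phi 0 = 0.
Proof.
by move=> phiD; have := phiD (-1) 0 0; rewrite scaler0 addr0 rmorphN rmorph1 mulN1r addNr.
Qed.

Definition kills_nonedges (phi : L -> algC) :=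
  forall i j, ~~ edge i j -> phi (lie (gen i) (gen j)) = 0 /\
    forall x, phi (lie x (lie (gen i) (gen j))) = 0.

Lemma kills_nonedge_ideal phi : functional phi -> kills_nonedges phi ->
  forall x, x \in nonedge_ideal E -> phi x = 0.
Proof.
move=> phiD phi0.
set X := [seq lie (free_gen p.1) (free_gen p.2) | p : S * S <- enum predT & ~~ E p.1 p.2].
pose U := (<<X>> + lie_span fullv <<X>>)%VS : {vspace L}.
have lie_X : forall x u, u \in <<X>>%VS -> forall y, lie x (lie y u) = 0.
  move=> x u; move: u; apply: span_ind => [y|a u v Hu Hv y|_ /mapP[p _ ->] y].
  - by rewrite !lie0r.
  - by rewrite !lieDr !lieZr Hu Hv scaler0 addr0.
  - exact: free_nil3_nil.
have UI : is_ideal U.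
  move=> x y /memv_addP[u uX [v vL ->]]; rewrite lieDr memvD //.
    by apply: (subvP (addvSr _ _)); apply: mem_lie_span; rewrite ?memvf.
  suff -> : lie x v = 0 by rewrite mem0v.
  move: v vL; apply: span_ind => [|a v1 v2 H1 H2|_ /allpairsP[[a b] /= [_ /vbasis_mem bX ->]]].
  - by rewrite lie0r.
  - by rewrite lieDr lieZr H1 H2 scaler0 addr0.
  - exact: lie_X.
have XU : {subset X <= U}.
  by move=> x xX; apply: (subvP (addvSl _ _)); apply: memv_span.
have phiX : {in X, forall u, phi u = 0 /\ forall x, phi (lie x u) = 0}.
  move=> _ /mapP[[s t] + ->]; rewrite mem_filter /= => /andP[st _].
  by rewrite -[s]enum_rankK -[t]enum_rankK; apply: phi0; rewrite /edge !enum_rankK.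
have p0 := functional0 phiD.
have phiX' : {in <<X>>%VS, forall u, phi u = 0 /\ forall x, phi (lie x u) = 0}.
  apply: span_ind => // [|a u v [u1 u2] [v1 v2]].
    by split=> // x; rewrite lie0r.
  split=> [|x]; first by rewrite phiD u1 v1 mulr0 addr0.
  by rewrite lieDr lieZr phiD u2 v2 mulr0 addr0.
move=> x /(subvP (ideal_gen_min UI XU)) /memv_addP[u uX [v vL ->]].
rewrite -[u]scale1r phiD (phiX' _ uX).1 mulr0 add0r.
move: v vL; apply: span_ind => [|a v1 v2 H1 H2|_ /allpairsP[[a b] /= [_ /vbasis_mem bX ->]]] //.
- by rewrite phiD H1 H2 mulr0 addr0.
- exact: (phiX' _ bX).2.
Qed.

End Coordinates.

Section QuotientByLine.
Variables (S : finType) (E : rel S).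
Hypotheses (E_sym : symmetric E) (E_irr : irreflexive E).
Variable X : graph_lie E.
Hypothesis X_V3 : X \in V3 E.

Local Notation n := #|S|.
Local Notation L := (free_nil3 S).
Local Notation Q := (graph_lie E).
Local Notation M := (quoLie (ideal_gen [:: X])).
Local Notation T3 := ('I_n * 'I_n * 'I_n)%type.
Local Notation form := {ffun T3 -> algC^o}.
Local Notation gen i := (free_gen (enum_val i)).
Local Notation edge := (edge E).

Let toQ (x : L) : Q := quo_pi (nonedge_ideal E) x.
Let ofQ (u : Q) : L := quo_repr u.
Let toM (x : L) : M := quo_pi (ideal_gen [:: X]) (toQ x).
Let ofM (m : M) : L := ofQ (quo_repr m).

Let toQP a x y : toQ (a *: x + y) = a *: toQ x + toQ y.
Proof. exact: linearP. Qed.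

Let ofQP a u v : ofQ (a *: u + v) = a *: ofQ u + ofQ v.
Proof. by rewrite /ofQ /quo_repr linearP. Qed.

Let ofMP a u v : ofM (a *: u + v) = a *: ofM u + ofM v.
Proof. by rewrite /ofM /ofQ /quo_repr !linearP. Qed.

Let toMP a x y : toM (a *: x + y) = a *: toM x + toM y.
Proof. by rewrite /toM toQP linearP. Qed.

Let piP a u v : quo_pi (ideal_gen [:: X]) (a *: u + v)
  = a *: quo_pi (ideal_gen [:: X]) u + quo_pi (ideal_gen [:: X]) v.
Proof. exact: linearP. Qed.

Let toQ_lie x y : toQ (lie x y) = lie (toQ x) (toQ y).
Proof. exact: quo_pi_lie. Qed.

Let toM_lie x y : toM (lie x y) = lie (toM x) (toM y).
Proof. by rewrite /toM toQ_lie; apply: quo_pi_lie. Qed.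

Let ofQK u : toQ (ofQ u) = u.
Proof. exact: quo_reprK. Qed.

Let ofMK m : toM (ofM m) = m.
Proof. by rewrite /toM /ofM ofQK; apply: quo_reprK. Qed.

Let toQK phi : functional phi -> kills_nonedges E phi ->
  forall x, phi (ofQ (toQ x)) = phi x.
Proof.
move=> phiD phi0 x; have := kills_nonedge_ideal phiD phi0 (quo_piK _ x).
rewrite -/(toQ x) -/(ofQ (toQ x)) => H.
have := phiD (-1) (ofQ (toQ x)) x.
by rewrite scaleN1r addrC H rmorphN rmorph1 mulN1r => /esym/eqP; rewrite addrC subr_eq0 => /eqP.
Qed.

Let line_quo (u : Q) : u \in (ideal_gen [:: X] : {vspace Q}) -> exists a, u = a *: X.
Proof. by rewrite ideal_gen_V3 // => /vlineP. Qed.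

Let toMK phi : functional phi -> kills_nonedges E phi -> phi (ofQ X) = 0 ->
  forall x, phi (ofM (toM x)) = phi x.
Proof.
move=> phiD phi0 phiX x; have [a Ea] := line_quo (quo_piK (ideal_gen [:: X]) (toQ x)).
rewrite -[RHS](toQK phiD phi0) /toM /ofM.
set v := quo_repr _ in Ea *; have Ex : toQ x = a *: X + v by rewrite -Ea subrK.
by rewrite [in RHS]Ex ofQP phiD phiX mulr0 add0r.
Qed.

Let V3_ind phi : functional phi -> kills_nonedges E phi ->
  (forall i j k : 'I_n, phi (lie (gen i) (lie (gen j) (gen k))) = 0) ->
  forall u, u \in V3 E -> phi (ofQ u) = 0.
Proof.
move=> phiD phi0 phi3; apply: span_ind => [|a u v Hu Hv|].
- by have := functional0 phiD; rewrite /ofQ /quo_repr linear0.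
- by rewrite ofQP phiD Hu Hv mulr0 addr0.
move=> _ /mapP[[[r s] t] _ ->] /=; rewrite /vert -/(toQ _) -/(toQ _) -/(toQ _) -!toQ_lie toQK //.
by rewrite -[r]enum_rankK -[s]enum_rankK -[t]enum_rankK phi3.
Qed.

Let phi1 i (x : L) : algC := ratr (tens1 x i).
Let phi2 i j (x : L) : algC := ratr (tens2 x i j).

Let phi1D i : functional (phi1 i).
Proof. by move=> a x y; rewrite /phi1 tens1P rmorphD rmorphM. Qed.

Let phi2D i j : functional (phi2 i j).
Proof. by move=> a x y; rewrite /phi2 tens2P rmorphD rmorphM. Qed.

Let triD (F : form) : functional (tri_pair F : L -> algC).
Proof. by move=> a x y; rewrite tri_pairP. Qed.

Let phi1_0 i : kills_nonedges E (phi1 i).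
Proof. by move=> j k _; split=> [|x]; rewrite /phi1 tens1_lie rmorph0. Qed.

Let edge_sym : symmetric edge.
Proof. by move=> i j; rewrite /edge E_sym. Qed.

Let edge_irr : irreflexive edge.
Proof. by move=> i; rewrite /edge E_irr. Qed.

Let phi2_0 i j : edge i j -> kills_nonedges E (phi2 i j).
Proof.
move=> ij k l kl; split=> [|x]; rewrite /phi2 tens2_lie; last first.
  by rewrite !tens1_lie mulr0 mul0r subr0 rmorph0.
rewrite !tens1_gen.
have -> : (i == k)%:R * (j == l)%:R = 0 :> rat.
  case: eqP => [ik|_]; last by rewrite mul0r.
  by case: eqP => [jl|_]; [rewrite -ik -jl ij in kl|rewrite mulr0].
have -> : (i == l)%:R * (j == k)%:R = 0 :> rat.
  case: eqP => [il|_]; last by rewrite mul0r.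
  by case: eqP => [jk|_]; [rewrite -il -jk edge_sym ij in kl|rewrite mulr0].
by rewrite subr0 rmorph0.
Qed.

Let tri_0 (F : form) : is_form edge F -> kills_nonedges E (tri_pair F).
Proof.
move=> Ff i j ij; split=> [|x].
  rewrite /tri_pair big1 ?mulr0 // => p _.
  rewrite tens3_lie /tens2 !val_free_gen /= !ffunE !(mulr0, mul0r) addr0 subr0.
  by rewrite rmorph0 mulr0.
rewrite (tri_pair_lie _ _ _ Ff) big1 // => -[[a b] c] _ /=.
rewrite !tens1_gen; have [bi|_] := eqVneq b i; last by rewrite rmorph0 mulr0 mul0r mulr0.
have [cj|_] := eqVneq c j; last by rewrite rmorph0 !mulr0.
by have [_ _ ->] := Ff; [rewrite mul0r|rewrite bi cj].
Qed.

Let phi1_X i : phi1 i (ofQ X) = 0.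
Proof. by apply: V3_ind => // j k l; rewrite /phi1 tens1_lie rmorph0. Qed.

Let phi2_X i j : edge i j -> phi2 i j (ofQ X) = 0.
Proof.
move=> ij; apply: V3_ind => //; first exact: phi2_0.
by move=> k l r; rewrite /phi2 tens2_lie !tens1_lie mulr0 mul0r subr0 rmorph0.
Qed.

Let c1 (m : M) i : rat := tens1 (ofM m) i.

Let c1_toM x i : c1 (toM x) i = tens1 x i.
Proof. by apply: (fmorph_inj (ratr : {rmorphism rat -> algC})); apply: (toMK (phi1D i)). Qed.

Let c1P a u v i : c1 (a *: u + v) i = a * c1 u i + c1 v i.
Proof. by rewrite /c1 ofMP tens1P. Qed.

Let c1_lie u v i : c1 (lie u v) i = 0.
Proof. by rewrite -(ofMK u) -(ofMK v) -toM_lie c1_toM tens1_lie. Qed.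

Let c2_lie u v i j : edge i j ->
  tens2 (ofM (lie u v)) i j = c1 u i * c1 v j - c1 v i * c1 u j.
Proof.
move=> ij; rewrite -{1}(ofMK u) -{1}(ofMK v) -toM_lie.
have := toMK (phi2D i j) (phi2_0 ij) (phi2_X ij) (lie (ofM u) (ofM v)).
by rewrite /phi2 => /fmorph_inj ->; rewrite tens2_lie.
Qed.

Let tri_lie (F : form) u v t : is_form edge F -> tri_pair F (ofQ X) = 0 ->
  tri_pair F (ofM (lie u (lie v t))) =
  \sum_p F p * (ratr (c1 u p.1.1) * ratr (c1 v p.1.2) * ratr (c1 t p.2)).
Proof.
move=> Ff FX; rewrite -{1}(ofMK u) -{1}(ofMK v) -{1}(ofMK t) -!toM_lie.
by rewrite (toMK (triD F) (tri_0 Ff) FX) (tri_pair_lie _ _ _ Ff).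
Qed.

Let vM (i : 'I_n) : M := toM (gen i).

Let c1_vM i j : c1 (vM j) i = (i == j)%:R.
Proof. by rewrite /vM c1_toM tens1_gen. Qed.


Let mod_brackets (phi : L -> rat) :
  (forall a x y, phi (a *: x + y) = a * phi x + phi y) ->
  (forall x y, phi (lie x y) = 0) ->
  forall x, phi x = \sum_i tens1 x i * phi (gen i).
Proof.
move=> phiD phi_lie x; rewrite /tens1 -{1}[x]vsvalK.
have phi_0 : phi 0 = 0 by rewrite -(lie0l (0 : L)) phi_lie.
move: (vsval x) (subvsP x); apply: subalg_gen_ind.
- rewrite linear0 phi_0 big1 // => i _; by rewrite ffunE mul0r.
- move=> a u v Hu Hv; rewrite linearP phiD Hu Hv big_distrr -big_split.
  apply: eq_bigr => i _; rewrite !ffunE mulrDl; congr (_ + _); exact: mulrA.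
- move=> u v uU vU _ _.
  have -> : vsproj _ (lie u v) = lie (vsproj _ u : L) (vsproj _ v).
    by apply: subvs_inj; rewrite subLieE !vsprojK //; apply: subalg_gen_subalg.
  by rewrite phi_lie big1 // => i _; rewrite /lie /= !ffunE subr0 mul0r.
- move=> _ /mapP[s _ ->]; rewrite -/(free_gen s) (bigD1 (enum_rank s)) //=.
  rewrite ffunE enum_rankK eqxx mul1r big1 ?addr0 // => i si.
  have /negPf Es : enum_val i != s by apply: contraNneq si => <-; rewrite enum_valK.
  by rewrite ffunE Es mul0r.
Qed.

Let tri_gen (F : form) (a b c : 'I_n) : is_form edge F ->
  tri_pair F (lie (gen a) (lie (gen b) (gen c))) = F (a, b, c).
Proof.
move=> Ff; rewrite (tri_pair_lie _ _ _ Ff) (bigD1 (a, b, c)) //= big1 => [|[[x y] z] ne].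
  by rewrite !tens1_gen !eqxx rmorph1 !mulr1 addr0.
rewrite /= !tens1_gen; have [xa|_] := eqVneq x a; last by rewrite rmorph0 !mul0r mulr0.
have [yb|_] := eqVneq y b; last by rewrite rmorph0 mulr0 mul0r mulr0.
have [zc|_] := eqVneq z c; last by rewrite rmorph0 !mulr0.
by rewrite xa yb zc eqxx in ne.
Qed.

Section Endomorphism.
Variable G : M -> M.
Hypotheses (GP : forall a u v, G (a *: u + v) = a *: G u + G v).
Hypothesis G_lie : lie_morphism G.

Definition deg1_mx (H : M -> M) : 'M[rat]_n := \matrix_(i, j) tens1 (ofM (H (toM (gen j)))) i.

Lemma c1_G m i : c1 (G m) i = \sum_j deg1_mx G i j * c1 m j.
Proof.
rewrite -{1}(ofMK m) (@mod_brackets (fun x => c1 (G (toM x)) i)).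
- by apply: eq_bigr => j _; rewrite mxE mulrC.
- by move=> a x y; rewrite toMP GP c1P.
- by move=> x y; rewrite toM_lie G_lie c1_lie.
Qed.

Let nonedge_lie i j : ~~ edge i j -> lie (vM i) (vM j) = 0.
Proof.
move=> ij; rewrite /vM -toM_lie /toM.
have -> : toQ (lie (gen i) (gen j)) = 0; last exact: linear0.
apply/eqP; rewrite -memv_ker lker_quo_pi mem_ideal_gen //.
by apply/mapP; exists (enum_val i, enum_val j) => //; rewrite mem_filter /= ij mem_enum.
Qed.

Lemma deg1_mx_compat : bracket_compat edge (deg1_mx G).
Proof.
move=> i i' j j' ii' jj'.
have := c2_lie (G (vM j)) (G (vM j')) ii'; rewrite -G_lie nonedge_lie //.
have G0 : G 0 = 0.
  by have := GP (-1) 0 0; rewrite scaler0 addr0 scaleN1r addNr.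
have of0 : ofM 0 = 0 by rewrite /ofM /ofQ /quo_repr !linear0.
have t0 : tens2 (0 : L) i i' = 0 by have := tens2_lie (0 : L) 0 i i'; rewrite lie0l subrr.
rewrite G0 of0 t0 => /esym/eqP; rewrite subr_eq0 => /eqP Eq.
by rewrite !mxE -!/(c1 _ _) Eq mulrC.
Qed.


Local Notation GK := (map_mx (ratr : rat -> algC) (deg1_mx G)).

Let lift_G u : incidence edge GK -> u \in V3 E ->
  exists2 u' : Q, quo_pi (ideal_gen [:: X]) u' = G (quo_pi (ideal_gen [:: X]) u) &
    forall F, is_form edge F -> tri_pair F (ofQ u') = tri_pair (pullback GK F) (ofQ u).
Proof.
move=> Gi; move: u; apply: span_ind => [|a u v [u' Eu Hu] [v' Ev Hv]|].
- have G0 : G 0 = 0 by have := GP (-1) 0 0; rewrite scaler0 addr0 scaleN1r addNr.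
  exists 0; first by rewrite linear0 G0.
  by move=> F Ff; rewrite /ofQ /quo_repr linear0 !(functional0 (@triD _)).
- exists (a *: u' + v'); first by rewrite !piP GP Eu Ev.
  by move=> F Ff; rewrite !ofQP !tri_pairP Hu ?Hv.
move=> _ /mapP[[[r s] t] _ ->] /=; rewrite /vert -/(toQ _) -/(toQ _) -/(toQ _) -!toQ_lie.
rewrite -[r]enum_rankK -[s]enum_rankK -[t]enum_rankK.
move: (enum_rank r) (enum_rank s) (enum_rank t) => a b c.
exists (toQ (lie (ofM (G (vM a))) (lie (ofM (G (vM b))) (ofM (G (vM c)))))).
  by rewrite -/(toM _) -/(toM _) !toM_lie !ofMK !G_lie.
move=> F Ff; have pF := pullback_form edge_sym Gi Ff.
rewrite (toQK (@triD F) (tri_0 Ff)) (toQK (@triD _) (tri_0 pF)) (tri_gen _ _ _ pF).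
rewrite (tri_pair_lie _ _ _ Ff) ffunE; apply: eq_bigr => p _.
by rewrite !mxE.
Qed.

Lemma eps_G : incidence edge GK -> exists mu : rat, forall F, is_form edge F ->
  tri_pair (pullback GK F) (ofQ X) = ratr mu * tri_pair F (ofQ X).
Proof.
move=> Gi; have [u' Eu Hu] := lift_G Gi X_V3.
have G0 : G 0 = 0 by have := GP (-1) 0 0; rewrite scaler0 addr0 scaleN1r addNr.
have X0 : quo_pi (ideal_gen [:: X]) X = 0.
  by apply/eqP; rewrite -memv_ker lker_quo_pi mem_ideal_gen ?mem_head.
have [mu Emu] : exists a, u' = a *: X.
  by apply: line_quo; rewrite -lker_quo_pi memv_ker Eu X0 G0.
exists mu => F Ff; rewrite -Hu // Emu -[_ *: _]addr0 ofQP tri_pairP.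
by rewrite {2}/ofQ /quo_repr linear0 (functional0 (@triD _)) addr0.
Qed.

End Endomorphism.

Let eps_neq0 : X != 0 -> exists2 F : form, is_form edge F & tri_pair F (ofQ X) != 0.
Proof.
move=> X0; pose b := vbasis {:Q}.
have [i bi] : exists i, coord b i X != 0.
  apply/existsP; apply: contraNT X0 => /existsPn H.
  rewrite (coord_vbasis (memvf X)) big1 // => i _.
  by have := H i; rewrite negbK => /eqP->; rewrite scale0r.
pose th u : rat := coord b i u.
pose br (x y z : 'I_n) : Q := lie (toQ (gen x)) (lie (toQ (gen y)) (toQ (gen z))).
pose F : form := [ffun p => ratr (th (br p.1.1 p.1.2 p.2))].
have th_D u v : th (u + v) = th u + th v by rewrite /th linearD.
have th_N u : th (- u) = - th u by rewrite /th linearN.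
have Ff : is_form edge F.
  split=> x y z; rewrite !ffunE /br /=.
  - by rewrite [X in lie _ X]lieC lieNr th_N rmorphN.
  - by rewrite -!rmorphD -!th_D lie_jacobi /th linear0 rmorph0.
  - move=> yz; rewrite -(toQ_lie (gen y)).
    have -> : toQ (lie (gen y) (gen z)) = 0.
      apply/eqP; rewrite -memv_ker lker_quo_pi mem_ideal_gen //.
      by apply/mapP; exists (enum_val y, enum_val z) => //; rewrite mem_filter /= yz mem_enum.
    by rewrite lie0r /th linear0 rmorph0.
exists F => //.
suff -> : tri_pair F (ofQ X) = ratr (th X) by rewrite fmorph_eq0.
move: X X_V3 {bi X0}; apply: span_ind => [|a u v Hu Hv|].
- by rewrite /th linear0 rmorph0 /ofQ /quo_repr linear0 (functional0 (@triD _)).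
- by rewrite ofQP tri_pairP Hu Hv /th linearP rmorphD rmorphM.
move=> _ /mapP[[[r s] t] _ ->] /=; rewrite /vert -/(toQ _) -/(toQ _) -/(toQ _).
rewrite -[r]enum_rankK -[s]enum_rankK -[t]enum_rankK -!toQ_lie.
by rewrite (toQK (@triD F) (tri_0 Ff)) tri_gen // ffunE /= /br !toQ_lie.
Qed.

Lemma no_hyperbolic_automorphism (f : 'End(M)) : X != 0 ->
  lie_automorphism f -> hyperbolic f -> integral_unit_char_poly f -> False.
Proof.
move=> X0 [f_lie [g fK gK]] f_hyp f_int.
have fP a u v : f (a *: u + v) = a *: f u + f v by exact: linearP.
have gP a u v : g (a *: u + v) = a *: g u + g v.
  by apply: (can_inj fK); rewrite fP !gK.
have g_lie : lie_morphism g.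
  by move=> u v; apply: (can_inj fK); rewrite f_lie !gK.
have itP k a u v : iter k f (a *: u + v) = a *: iter k f u + iter k f v.
  by elim: k => //= k ->; rewrite fP.
have it_lie k : lie_morphism (iter k f).
  by move=> u v; elim: k => //= k ->; rewrite f_lie.
have AA' : deg1_mx f *m deg1_mx g = 1%:M.
  apply/matrixP=> i j; rewrite !mxE -c1_vM -[in RHS](gK (vM j)) (c1_G fP f_lie).
  by apply: eq_bigr => k _; rewrite !mxE.
have pwE k : iter k (mulmx (deg1_mx f)) 1%:M = deg1_mx (iter k f).
  elim: k => [|k IH]; apply/matrixP=> i j.
    by rewrite !mxE /= -/(c1 _ _) -/(vM j) c1_vM.
  rewrite iterS IH [RHS]mxE -/(c1 _ _) (c1_G fP f_lie) mxE.
  by apply: eq_bigr => l _; rewrite [X in _ * X]mxE.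
have c1_it k u i : ratr (c1 (iter k f u) i) =
    \sum_l map_mx (ratr : rat -> algC) (deg1_mx (iter k f)) i l * ratr (c1 u l).
  rewrite (c1_G (itP k) (@it_lie k)) rmorph_sum; apply: eq_bigr => l _.
  by rewrite !mxE rmorphM.
have hyp_pow y k : (0 < k)%N -> eigenvalue (map_mx (ratr : rat -> algC) (lfun_mx f)) y ->
    `|y ^+ k| != 1.
  by move=> k0 /f_hyp; rewrite normrX pexpr_eq1.
apply: (@no_hyperbolic_incidence _ edge (deg1_mx f) (deg1_mx g)
  (fun F => tri_pair F (ofQ X)) edge_sym edge_irr (deg1_mx_compat fP f_lie)
  (deg1_mx_compat gP g_lie) AA').
- by move=> a F1 F2; rewrite tri_pairPl.
- exact: eps_neq0.
- by move=> k; rewrite pwE => /(eps_G (itP k) (@it_lie k)).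
- move=> k F z k0 Ff Fn FX; rewrite pwE => Fz.
  have [[[a b] c] Fabc] : exists p, F p != 0.
    apply/existsP; apply: contraNT Fn => /existsPn H; apply/eqP/ffunP=> p.
    by have := H p; rewrite negbK ffunE => /eqP.
  have psi_k u v t : tri_pair F (ofM (iter k f (lie u (lie v t))))
      = z * tri_pair F (ofM (lie u (lie v t))).
    rewrite !it_lie !(tri_lie _ _ _ Ff FX).
    under eq_bigr do rewrite !c1_it.
    rewrite sum_pullback Fz big_distrr; apply: eq_bigr => p _ /=.
    by rewrite ffunE; symmetry; exact: mulrA.
  have [|||y ey <-] := @eigenvalue_of_functional _ f (fun m => tri_pair F (ofM m)) k z
      (lie (vM a) (lie (vM b) (vM c))).
  + by move=> x u v; rewrite ofMP tri_pairP.
  + by move=> j; rewrite !(it_lie j) psi_k.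
  + by rewrite /vM -!toM_lie (toMK (@triD F) (tri_0 Ff) FX) tri_gen.
  exact: hyp_pow.
- move=> k v z k0 v0; rewrite pwE => vz.
  have [i vi] : exists i, v 0 i != 0.
    apply/existsP; apply: contraNT v0 => /existsPn H; apply/eqP/rowP=> i.
    by have := H i; rewrite negbK mxE => /eqP.
  have psi_k u : \sum_i v 0 i * ratr (c1 (iter k f u) i) = z * \sum_i v 0 i * ratr (c1 u i).
    under eq_bigr do rewrite c1_it big_distrr.
    rewrite exchange_big big_distrr; apply: eq_bigr => l _ /=.
    have := congr1 (fun r : 'rV_n => r 0 l) vz; rewrite mxE [in RHS]mxE mulrA => <-.
    by rewrite big_distrl; apply: eq_bigr => j _; rewrite /= mulrA.
  have [|||y ey Ey] := @eigenvalue_of_functional _ f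
      (fun m => \sum_i v 0 i * ratr (c1 m i)) k z (vM i).
  + move=> a u w; rewrite big_distrr -big_split; apply: eq_bigr => j _ /=.
    by rewrite c1P rmorphD rmorphM /=; ring.
  + by move=> j; rewrite psi_k.
  + rewrite (bigD1 i) //= c1_vM eqxx rmorph1 mulr1 big1 ?addr0 // => j ji.
    by rewrite c1_vM (negPf ji) rmorph0 mulr0.
  have [y0 yA yVA] := eigenvalue_unit f_int ey.
  rewrite -Ey; split; [exact: expf_neq0|exact: rpredX| |exact: hyp_pow].
  by rewrite -exprVn; apply: rpredX.
Qed.

End QuotientByLine.

Theorem theorem6p3 (S : finType) (E : rel S)
    (E_sym : symmetric E) (E_irr : irreflexive E)
    (X : graph_lie E) (X_neq0 : X != 0) (X_V3 : X \in V3 E) :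
  ~ exists f : 'End(quoLie (ideal_gen [:: X])),
      [/\ lie_automorphism f, hyperbolic f & integral_unit_char_poly f].
Proof.
by case=> f [f_aut f_hyp f_int]; apply: (no_hyperbolic_automorphism _ _ X_V3 X_neq0 f_aut).
Qed.
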